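(* The automorphism groups of the one-dimensional simply connected locally $\mathbb{C}$-Nash groups are as follows: $\mathrm{Aut}(\mathbb{C},+,\mathrm{id})\cong\mathbb{C}^*$, $\mathrm{Aut}(\mathbb{C},+,\exp)\cong\mathbb{Q}^*$ and, for each $\omega\in\mathbb{C}\setminus\mathbb{R}$, $\mathrm{Aut}(\mathbb{C},+,\wp_\omega)\cong K_\omega^*$ (all multiplicative groups).
   Context: For $\omega\in\mathbb{C}\setminus\mathbb{R}$: $K_\omega:=\mathbb{Q}(\omega)$ if $\omega$ is quadratic over $\mathbb{Q}$, and $K_\omega:=\mathbb{Q}$ otherwise; $\wp_\omega$ is the Weierstrass $\wp$-function of the lattice $\mathbb{Z}+\mathbb{Z}\omega$. A holomorphic function on an open subset of $\mathbb{C}^n$ is locally $\mathbb{C}$-Nash if near each point it satisfies a nontrivial polynomial equation over the polynomials in the coordinates. A locally $\mathbb{C}$-Nash group is a complex analytic group with an atlas whose transition maps are locally $\mathbb{C}$-Nash and such that the group operations are locally $\mathbb{C}$-Nash in the charts; isomorphisms are group isomorphisms that are locally $\mathbb{C}$-Nash in both directions. For $f\in\{\mathrm{id},\exp,\wp_\omega\}$, $(\mathbb{C},+,f)$ denotes $(\mathbb{C},+)$ with the locally $\mathbb{C}$-Nash structure whose atlas is given by the translates of a chart $u\mapsto f(u+a)$ ($u$ near $0$), where $a\in\mathbb{C}$ is a point near which $f$ is a local analytic diffeomorphism. The automorphisms of $(\mathbb{C},+,f)$ are exactly the maps $u\mapsto au$, $a\in\mathbb{C}^*$, such that $f(au)$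 is algebraic over $\mathbb{C}(f(u))$. Every simply connected one-dimensional locally $\mathbb{C}$-Nash group is isomorphic to one of these. *)

(* Defs.v *)
From HB Require Import structures.
From mathcomp Require Import all_boot all_order all_algebra complex.
From mathcomp Require Import all_classical all_reals all_analysis.
From mathcomp Require Import showcase.summability.

Set Implicit Arguments.
Unset Strict Implicit.
Unset Printing Implicit Defensive.

Import Order.TTheory GRing.Theory Num.Theory numFieldNormedType.Exports.
Local Open Scope classical_set_scope.
Local Open Scope ring_scope.

(* R[i] packed as a numClosedFieldType: the topological and normed structures
   of numFieldNormedType are keyed on the projections of such packed types. *)
Definition Cplx (R : realType) : numClosedFieldType := R[i]%C.

Section LocallyNash.
Variable R : realType.
Local Notation C := (Cplx R).

Definition holomorphic_on (D : set C) (h : C -> C) : Prop :=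
  open D /\ forall z, D z -> derivable h z 1.

(* P : {poly {poly C}} is a polynomial in the unknown Y with coefficients in
   C[X]; P.[(h w)%:P].[w] substitutes X := w and Y := h w. *)
Definition locally_nash_on (D : set C) (h : C -> C) : Prop :=
  holomorphic_on D h /\
  forall z, D z -> exists2 P : {poly {poly C}},
    P != 0 & \forall w \near z, P.[(h w)%:P].[w] = 0.

Definition biholomorphic_on (U : set C) (phi : C -> C) : Prop :=
  holomorphic_on U phi /\
  exists psi : C -> C,
    holomorphic_on (phi @` U) psi /\ {in U, cancel phi psi}.

Record chart (T : Type) := Chart { chart_dom : set T; chart_map :> T -> C }.

(* h is the expression psi \o g \o phi^-1 of g in the charts phi and psi; that
   its domain is open is part of locally_nash_on. *)
Definition locally_nash_map (S T : Type) (A : set (chart S)) (B : set (chart T))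
    (g : S -> T) : Prop :=
  forall (phi : chart S) (psi : chart T), A phi -> B psi ->
  exists h : C -> C,
    locally_nash_on (phi @` (chart_dom phi `&` g @^-1` chart_dom psi)) h /\
    forall x, chart_dom phi x -> chart_dom psi (g x) -> h (phi x) = psi (g x).

Definition locally_nash_iso (G H : zmodType) (A : set (chart G))
    (B : set (chart H)) (g : G -> H) : Prop :=
  {morph g : x y / x + y} /\
  exists g' : H -> G,
    [/\ cancel g g', cancel g' g, locally_nash_map A B g
      & locally_nash_map B A g'].

Definition locally_nash_aut (G : zmodType) (A : set (chart G)) : set (G -> G) :=
  [set g | locally_nash_iso A A g].

(* u |-> f (u + a), for u in U, is a chart of C at 0. *)
Definition chart_at_origin (f : C -> C) (a : C) (U : set C) : Prop :=
  U 0 /\ biholomorphic_on U (fun u => f (u + a)).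

Definition translates (f : C -> C) (a : C) (U : set C) : set (chart C) :=
  range (fun c : C => Chart [set x | U (x - c)] (fun x => f (x - c + a))).

(* The group Aut, under composition, of C with the atlas of all translates of
   u |-> f (u + a) is isomorphic to the multiplicative group of the subfield K,
   whatever the choice of that chart. *)
Definition Aut_isog_units (f : C -> C) (K : set C) : Prop :=
  forall (a : C) (U : set C), chart_at_origin f a U ->
  exists Phi : C -> (C -> C),
    set_bij (K `\ 0) (locally_nash_aut (translates f a U)) Phi /\
    forall x y, (K `\ 0) x -> (K `\ 0) y -> Phi (x * y) = Phi x \o Phi y.

Definition cexp (z : C) : C :=
  (expR (complex.Re z) * cos (complex.Im z) +i*
   (expR (complex.Re z) * sin (complex.Im z)))%C.

Definition lattice_pt (w : C) (p : int * int) : C := p.1%:~R + p.2%:~R * w.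

(* [sum] is the unordered sum: the limit of the finite partial sums along the
   directed set of finite sets of indices.  At the points of the lattice the
   value is meaningless. *)
Definition weierstrass_p (w z : C) : C :=
  z ^- 2 + sum (fun p : int * int =>
    if p == (0, 0) then 0
    else (z - lattice_pt w p) ^- 2 - lattice_pt w p ^- 2 : C).

Definition rationals : set C := range (ratr : rat -> C).

(* Q(w), as the smallest subfield of C containing w. *)
Definition adjoin_rationals (w : C) : set C :=
  [set z | forall S : {pred C}, GRing.divring_closed S -> w \in S -> z \in S].

Definition quadratic (w : C) : Prop :=
  exists p : {poly rat},
    [/\ irreducible_poly p, size p = 3%N & root (map_poly ratr p) w].

Definition K_ (w : C) : set C :=
  if `[< quadratic w >] then adjoin_rationals w else rationals.

End LocallyNash.

(* Main.v *)
Require Import Defs.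
From HB Require Import structures.
From mathcomp Require Import all_boot all_order all_algebra complex.
From mathcomp Require Import all_classical all_reals all_analysis.
From mathcomp Require Import ring lra zify finmap showcase.summability.

Set Implicit Arguments.
Unset Strict Implicit.
Unset Printing Implicit Defensive.

Import Order.TTheory GRing.Theory Num.Theory numFieldNormedType.Exports.
Local Open Scope classical_set_scope.
Local Open Scope ring_scope.

(** An additive map that is differentiable at [0] is a homothety [u |-> alpha u],
    so an automorphism of [(C, +, f)] is an [alpha <> 0] such that
    [f (alpha u + a)] is algebraic over [f (u + a)] near [0].

    For [exp] these are the nonzero rationals, because finitely many characters
    [u |-> exp (lambda u)] with distinct [lambda] are linearly independent on
    every neighbourhood of [0].

    For the Weierstrass function of a lattice [L] they are the [alpha] with
    [q alpha L] included in [L] for some integer [q > 0].  If there is such a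
    [q], then [f (q z + a)] and [f (q alpha z + b)] have the same periods, and
    Siegel's lemma yields a nonzero polynomial in both without poles and with a
    zero; it vanishes identically by Liouville's theorem.  Conversely, by the
    identity theorem the algebraic relation holds on the whole plane, where
    replacing [u] by [u + l], for [l] in [L], leaves [f (u + a)] unchanged and
    translates the other argument by [alpha l]; if no multiple of [alpha l] were
    in [L], Dirichlet's approximation theorem would give more small translations
    modulo [L] than the polynomial has roots.  These [alpha] form a subfield of
    the complex numbers, which is [K_ w].

    Analyticity at a point is the existence of Taylor remainders of all orders
    with geometric bounds; this class is closed under the operations needed, and
    it yields the maximum principle and isolated zeros without any integral. *)

(** * The modulus of a complex number *)

Section Modulus.
Variable R : realType.
Local Notation C := (Cplx R).

(** The algebraic dependence of two elliptic functions with common periods is obtained by counting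
    Taylor coefficients, not from an addition theorem or a differential equation, so no derivative
    of the Weierstrass function is computed. What is needed instead is a notion of analyticity that
    passes to infinite sums: Taylor remainders can be summed order by order as soon as the radius
    and the geometric rate are common to all terms. Complex differentiability enters only through
    the charts, where it gives continuity and the linearity of automorphisms.

    Two points shape the statements. Charts at different translates differ by an offset, so
    constructing an automorphism requires a relation between [f (u + a)] and [f (alpha * u + b + a)]
    for every [b], whereas the converse uses only [b = 0] near the origin. And since inversion is
    total, [weierstrass_p] takes finite default values at the lattice points: unboundedness nearby
    keeps these points out of the charts, and statements about poles are made on punctured discs,
    which ignore such values. *)

Definition cabs (z : C) : R := complex.Re `|z|.

(** The norm on [C] is itself complex valued; [cabs] moves every estimate to [R], where the order is
    total. *)
Lemma cabsE (z : C) : `|z| = (cabs z)%:C%C.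
Proof. by rewrite /cabs [ `|z| ]normc_def. Qed.

Lemma cabs_sqrt (z : C) :
  cabs z = Num.sqrt (complex.Re z ^+ 2 + complex.Im z ^+ 2).
Proof. by rewrite /cabs [ `|z| ]normc_def. Qed.

Lemma cabs_ge0 z : 0 <= cabs z.
Proof. by rewrite cabs_sqrt sqrtr_ge0. Qed.

Lemma cabsM x y : cabs (x * y) = cabs x * cabs y.
Proof. by apply: (@complexI R); rewrite rmorphM /= -!cabsE normrM. Qed.

Lemma cabsD x y : cabs (x + y) <= cabs x + cabs y.
Proof. by rewrite -(@lecR R) rmorphD /= -!cabsE ler_normD. Qed.

Lemma cabsN x : cabs (- x) = cabs x.
Proof. by rewrite /cabs normrN. Qed.

Lemma cabs0 : cabs 0 = 0. Proof. by rewrite /cabs normr0. Qed.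

Lemma cabs1 : cabs 1 = 1. Proof. by rewrite /cabs normr1. Qed.

Lemma cabs_eq0 x : (cabs x == 0) = (x == 0).
Proof. by rewrite -(inj_eq (@complexI R)) -cabsE normr_eq0. Qed.

Lemma cabs_gt0 x : (0 < cabs x) = (x != 0).
Proof. by rewrite lt_neqAle cabs_ge0 andbT eq_sym cabs_eq0. Qed.

Lemma cabsX x n : cabs (x ^+ n) = cabs x ^+ n.
Proof. by elim: n => [|n IHn]; rewrite ?expr0 ?cabs1 // !exprS cabsM IHn. Qed.

Lemma cabsV x : cabs x^-1 = (cabs x)^-1.
Proof.
have [->|x0] := eqVneq x 0; first by rewrite invr0 cabs0 invr0.
apply: (mulfI (x := cabs x)); first by rewrite cabs_eq0.
by rewrite -cabsM !divff ?cabs1 ?cabs_eq0.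
Qed.

Lemma cabsB x y : cabs (x - y) = cabs (y - x).
Proof. by rewrite -cabsN opprB. Qed.

Lemma cabs_lb x y : cabs x - cabs y <= cabs (x + y).
Proof.
by rewrite lerBlDr -{1}(addrK y x) (le_trans (cabsD _ _)) ?cabsN.
Qed.

Lemma cabs_real (x : R) : cabs x%:C%C = `|x|.
Proof. by rewrite cabs_sqrt /= expr0n addr0 sqrtr_sqr. Qed.

Lemma cabs_nat n : cabs n%:R = n%:R.
Proof. by rewrite -(rmorph_nat (real_complex R)) cabs_real normr_nat. Qed.

Lemma cabs_Re (z : C) : `|complex.Re z| <= cabs z.
Proof.
by rewrite cabs_sqrt -sqrtr_sqr ler_sqrt ?lerDl ?addr_ge0 ?sqr_ge0.
Qed.

Lemma cabs_Im (z : C) : `|complex.Im z| <= cabs z.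
Proof.
by rewrite cabs_sqrt -sqrtr_sqr ler_sqrt ?lerDr ?addr_ge0 ?sqr_ge0.
Qed.

Lemma cRe_add (x y : C) : complex.Re (x + y) = complex.Re x + complex.Re y.
Proof. by case: x y => [a b] [c d]. Qed.

Lemma cIm_add (x y : C) : complex.Im (x + y) = complex.Im x + complex.Im y.
Proof. by case: x y => [a b] [c d]. Qed.

Lemma cabs_le_ReIm (z : C) : cabs z <= `|complex.Re z| + `|complex.Im z|.
Proof.
have -> : `|complex.Re z| + `|complex.Im z| =
    Num.sqrt ((`|complex.Re z| + `|complex.Im z|) ^+ 2).
  by rewrite sqrtr_sqr [RHS]ger0_norm ?addr_ge0.
rewrite cabs_sqrt ler_sqrt ?sqr_ge0 // sqrrD !real_normK ?num_real //.
by rewrite addrAC lerDl mulrn_wge0 ?mulr_ge0.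
Qed.

Lemma cabs_sum (I : Type) (s : seq I) (P : pred I) (F : I -> C) :
  cabs (\sum_(i <- s | P i) F i) <= \sum_(i <- s | P i) cabs (F i).
Proof.
elim/big_ind2: _ => [|x1 x2 y1 y2 h1 h2|//]; first by rewrite cabs0.
exact: le_trans (cabsD _ _) (lerD h1 h2).
Qed.

Lemma nonreal_Im (z : C) : z \isn't Num.real -> complex.Im z != 0.
Proof. by case: z => a b; rewrite complex_real. Qed.

Lemma nbhs_cabs (p : C) (A : set C) :
  nbhs p A <-> exists2 r : R, 0 < r & forall w, cabs w < r -> A (p + w).
Proof.
split=> [/nbhs_ballP[e /= e0 eA]|[r r0 rA]].
  (* A positive element of [C] is real, so its real part is a radius in [R]. *)
  have eE : e = (complex.Re e)%:C%C by rewrite RRe_real // ger0_real // ltW.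
  exists (complex.Re e); first by rewrite -ltcR -eE.
  move=> w wr; apply: eA; rewrite /ball /= opprD addNKr normrN cabsE eE.
  by rewrite ltcR.
apply/nbhs_ballP; exists r%:C%C => [|y]; first by rewrite /= ltcR.
rewrite /ball /= cabsE ltcR => yr; rewrite -(subrK p y) addrC; apply: rA.
by rewrite cabsB.
Qed.

Lemma open_cabs (A : set C) :
  (forall p, A p -> exists2 r : R, 0 < r & forall w, cabs w < r -> A (p + w)) ->
  open A.
Proof. by move=> h; rewrite openE => p /h /nbhs_cabs. Qed.

Lemma cvg_cabs (T : Type) (F : set_system T) (FF : Filter F) (f : T -> C) (l : C) :
  (f x @[x --> F] --> l) <->
  (forall e : R, 0 < e -> \forall x \near F, cabs (f x - l) < e).
Proof.
split=> [/cvgrPdist_lt fl e e0|fl].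
  have /fl : 0 < e%:C%C :> C by rewrite ltcR.
  by apply: filterS => x; rewrite /= cabsE ltcR cabsB.
apply/cvgrPdist_lt => e e0.
have eE : e = (complex.Re e)%:C%C by rewrite RRe_real // ger0_real // ltW.
have /fl : 0 < complex.Re e by rewrite -ltcR -eE.
by apply: filterS => x; rewrite cabsE eE ltcR cabsB.
Qed.

End Modulus.

(** * Linear algebra and bivariate polynomials *)

(** More unknowns than equations: the rank is at most [#|J|], so the left kernel is nonzero. *)
Lemma kernel_exists (K : fieldType) (I J : finType) (A : I -> J -> K) :
  (#|J| < #|I|)%N ->
  exists c : I -> K, (exists i, c i != 0) /\ forall j, \sum_i c i * A i j = 0.
Proof.
move=> JI; pose M := \matrix_(i < #|I|, j < #|J|) A (enum_val i) (enum_val j).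
have K0 : kermx M != 0.
  rewrite -mxrank_eq0 mxrank_ker subn_eq0 -ltnNge.
  exact: leq_ltn_trans (rank_leq_col _) JI.
pose v := nz_row (kermx M).
have v0 : v != 0 by rewrite nz_row_eq0.
have vM : v *m M = 0 by apply/sub_kermxP/nz_row_sub.
exists (fun i => v 0 (enum_rank i)); split.
  have /rV0Pn[k vk] := v0; exists (enum_val k); by rewrite enum_valK.
move=> j; have /matrixP/(_ 0 (enum_rank j)) := vM.
rewrite !mxE => {2}<-; rewrite (reindex (@enum_val I predT)) /=.
  by apply: eq_bigr => i _; rewrite mxE enum_valK enum_rankK.
by apply: onW_bij; apply: enum_val_bij.
Qed.

Section BivariatePolynomials.

Definition bipoly (K : nzRingType) n (c : 'I_n * 'I_n -> K) : {poly {poly K}} :=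
  \sum_i (c i *: 'X^(i.1))%:P * 'X^(i.2).

Lemma bipoly_eval (K : comNzRingType) n (c : 'I_n * 'I_n -> K) x y :
  (bipoly c).[y%:P].[x] = \sum_i c i * (x ^+ i.1 * y ^+ i.2).
Proof.
rewrite !horner_sum; apply: eq_bigr => i _.
by rewrite !hornerE ?mulrA.
Qed.

Lemma bipoly_neq0 (K : nzRingType) n (c : 'I_n * 'I_n -> K) :
  (exists i, c i != 0) -> bipoly c != 0.
Proof.
move=> [i ci]; apply: contraNneq ci => P0.
have : ((bipoly c)`_(i.2))`_(i.1) = 0 by rewrite P0 !coef0.
rewrite !coef_sum (bigD1 i) //= big1 => [|k ki].
  by rewrite coefCM coefXn eqxx mulr1 coefZ coefXn eqxx mulr1 addr0 => ->.
rewrite coefCM coefXn; case: eqVneq => e2; last by rewrite mulr0 coef0.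
rewrite mulr1 coefZ coefXn; case: eqVneq => e1; last by rewrite mulr0.
by case/eqP: ki; case: k i e1 e2 => [k1 k2] [i1 i2] /= e1 e2; congr pair; apply: val_inj.
Qed.

(** A rectangle containing the support of [P], as a list, so that [P] becomes a finite combination
    of monomials with distinct exponents. *)
Definition bidegrees (K : nzRingType) (P : {poly {poly K}}) : seq (nat * nat) :=
  [seq (i, j) | i <- iota 0 (\max_(j < size P) size (P`_j)%R)%N, j <- iota 0 (size P)].

Lemma bivariate_horner (K : comNzRingType) (P : {poly {poly K}}) x y :
  P.[y%:P].[x] =
  \sum_(k <- bidegrees P) P`_(k.2)`_(k.1) * (x ^+ k.1 * y ^+ k.2).
Proof.
rewrite /bidegrees; pose N := (\max_(j < size P) size (P`_j)%R)%N; rewrite -/N.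
rewrite big_allpairs_dep /= exchange_big /=.
have -> : iota 0 (size P) = index_iota 0 (size P) by rewrite /index_iota subn0.
have -> : iota 0 N = index_iota 0 N by rewrite /index_iota subn0.
rewrite big_mkord [P.[y%:P]]horner_coef horner_sum; apply: eq_bigr => j _.
rewrite hornerM -polyC_exp hornerC big_mkord (@horner_coef_wide _ N).
  by rewrite mulr_suml; apply: eq_bigr => i _; rewrite mulrA.
exact: (leq_bigmax (F := fun j : 'I_(size P) => size (P`_j)%R)).
Qed.

Lemma bidegrees_eq0 (K : nzRingType) (P : {poly {poly K}}) :
  {in bidegrees P, forall k, P`_(k.2)`_(k.1) = 0} -> P = 0.
Proof.
move=> P0; apply/eqP/negPn/negP => Pn0.
have sP : (0 < size P)%N by rewrite size_poly_gt0.
pose j := (size P).-1; have jP : (j < size P)%N by rewrite prednK.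
have Pj : P`_j != 0 by rewrite -lead_coefE lead_coef_eq0.
have sPj : (0 < size (P`_j)%R)%N by rewrite size_poly_gt0.
have kP : ((size (P`_j)%R).-1, j) \in bidegrees P.
  apply: allpairs_f; rewrite mem_iota add0n //= prednK //.
  exact: (leq_bigmax (F := fun j : 'I_(size P) => size (P`_j)%R) (Ordinal jP)).
by have /eqP := P0 _ kP; rewrite /= -lead_coefE lead_coef_eq0 (negbTE Pj).
Qed.

(** The shape [p(X) * Y ^ n - c] is the relation satisfied by an exponential with negative rational
    exponent. *)
Lemma polymul_horner (K : comNzRingType) (p : {poly K}) n c x y :
  (p%:P * 'X^n - c%:P%:P).[y%:P].[x] = p.[x] * y ^+ n - c.
Proof. by rewrite !hornerE. Qed.

Lemma polymul_neq0 (K : nzRingType) (p : {poly K}) n c : (0 < n)%N -> p != 0 ->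
  p%:P * 'X^n - c%:P%:P != 0.
Proof.
move=> n0; apply: contraNneq => P0; have : (p%:P * 'X^n - c%:P%:P)`_n = 0.
  by rewrite P0 coef0.
by rewrite coefB coefCM coefXn eqxx mulr1 coefC gtn_eqF // subr0 => ->.
Qed.

End BivariatePolynomials.

(** * Analytic and meromorphic germs *)

Section Germs.
Variable R : realType.
Local Notation C := (Cplx R).
Implicit Types (f g : C -> C) (a b : nat -> C) (p c z w : C).

(* [F n] is the n-th Taylor remainder [(f - sum_(k < n) a k w^k) / w^n]. *)
Definition remainders (F : nat -> C -> C) (r M K : R) :=
  forall n w, cabs w < r ->
    F n w = F n 0 + w * F n.+1 w /\ cabs (F n w) <= M * K ^+ n.

Definition germ f p a := exists (F : nat -> C -> C) (r M K : R),
  [/\ 0 < r, 0 < K, remainders F r M K,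
      forall w, cabs w < r -> f (p + w) = F 0%N w & forall n, a n = F n 0].

Lemma remainders_M_ge0 F (r M K : R) : 0 < r -> remainders F r M K -> 0 <= M.
Proof.
move=> r0 /(_ 0%N 0); rewrite cabs0 => /(_ r0)[_]; rewrite expr0 mulr1.
exact: le_trans (cabs_ge0 _).
Qed.

Lemma germ_ext f g p a (r : R) : 0 < r ->
  (forall w, cabs w < r -> f (p + w) = g (p + w)) -> germ g p a -> germ f p a.
Proof.
move=> r0 fg [F [s [M [K [s0 K0 FP gF aF]]]]].
exists F, (Num.min r s), M, K; split=> //; first by rewrite lt_min r0.
  by move=> n w; rewrite lt_min => /andP[_]; apply: FP.
by move=> w; rewrite lt_min => /andP[wr ws]; rewrite fg // gF.
Qed.

Lemma germ_val f p a : germ f p a -> f p = a 0%N.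
Proof.
move=> [F [s [M [K [s0 K0 FP gF aF]]]]].
by rewrite aF -gF ?addr0 // cabs0.
Qed.

Lemma germ_coef f p a b : a =1 b -> germ f p a -> germ f p b.
Proof. by move=> /funext->. Qed.

Lemma germ_cst c p : germ (fun=> c) p (fun n => if n == 0%N then c else 0).
Proof.
exists (fun n w => if n == 0%N then c else 0), 1, (cabs c), 1.
split=> // n w _; rewrite expr1n mulr1 mulr0 addr0; split=> //.
by case: ifP; rewrite // cabs0 cabs_ge0.
Qed.

Lemma germ_sub p : germ (fun z => z - p) p (fun n => (n == 1%N)%:R).
Proof.
exists (fun n w => if n is 0%N then w else if n is 1%N then 1 else 0), 1, 1, 1.
split=> [//|//|[|[|n]] w wr|w _|[|[|n]]//]; rewrite ?expr1n ?mulr1 ?mulr0 ?addr0.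
- by rewrite add0r ltW.
- by rewrite cabs1.
- by rewrite cabs0 ler01.
- by rewrite addrC addKr.
Qed.

Lemma germ_add f g p a b : germ f p a -> germ g p b ->
  germ (fun z => f z + g z) p (fun n => a n + b n).
Proof.
move=> [F [r [M [K [r0 K0 FP gF aF]]]]] [G [s [N [L [s0 L0 GP gG bG]]]]].
have M0 := remainders_M_ge0 r0 FP; have N0 := remainders_M_ge0 s0 GP.
exists (fun n w => F n w + G n w), (Num.min r s), (M + N), (K + L).
split; rewrite ?lt_min ?r0 ?addr_gt0 //.
- move=> n w; rewrite lt_min => /andP[wr ws].
  have [F1 F2] := FP n w wr; have [G1 G2] := GP n w ws; split.
    by rewrite {1}F1 {1}G1; ring.
  apply: le_trans (cabsD _ _) _; rewrite mulrDl lerD //.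
    by apply: le_trans F2 _; rewrite ler_wpM2l // lerXn2r ?nnegrE ?ltW //
      ?addr_gt0 // ltrDl.
  by apply: le_trans G2 _; rewrite ler_wpM2l // lerXn2r ?nnegrE ?ltW //
      ?addr_gt0 // ltrDr.
- by move=> w; rewrite lt_min => /andP[wr ws]; rewrite gF // gG.
- by move=> n; rewrite aF bG.
Qed.

Lemma germ_mul f g p a b : germ f p a -> germ g p b ->
  germ (fun z => f z * g z) p (fun n => \sum_(k < n.+1) a k * b (n - k)%N).
Proof.
move=> [F [r [M [K [r0 K0 FP gF aF]]]]] [G [s [N [L [s0 L0 GP gG bG]]]]].
have M0 := remainders_M_ge0 r0 FP; have N0 := remainders_M_ge0 s0 GP.
(* In the product, [f] is expanded to order [n]; what remains beside its [k]-th coefficient is the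
   remainder of [g] of order [n - k]. *)
pose H n w := \sum_(k < n) F k 0 * G (n - k)%N w + F n w * G 0%N w.
pose B := (K + L).
have B0 : 0 < B by rewrite addr_gt0.
(* [H n] has [n + 1] terms, each at most [M * N * B ^+ n]; the factor 2 absorbs their number because
   [n + 1 <= 2 ^ n]. *)
exists H, (Num.min r s), (M * N), (2 * B).
have KB n : K ^+ n <= B ^+ n by rewrite lerXn2r ?nnegrE ?ltW // ltrDl.
have LB n : L ^+ n <= B ^+ n by rewrite lerXn2r ?nnegrE ?ltW // ltrDr.
split; rewrite ?lt_min ?r0 ?mulr_gt0 //.
- move=> n w; rewrite lt_min => /andP[wr ws].
  have w0r : cabs (0 : C) < r by rewrite cabs0.
  split.
    have HS : \sum_(k < n) F k 0 * G (n - k)%N w = \sum_(k < n) F k 0 * G (n - k)%N 0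
        + w * \sum_(k < n) F k 0 * G (n.+1 - k)%N w.
      rewrite mulr_sumr -big_split /=; apply: eq_bigr => k _.
      rewrite subSn ?(ltnW (ltn_ord k)) // mulrCA -mulrDr.
      by have [<-] := GP (n - k)%N w ws.
    rewrite /H big_ord_recr /= subSnn HS; have [-> _] := FP n w wr.
    by have [-> _] := GP 0%N w ws; ring.
  apply: le_trans (_ : n.+1%:R * (M * N * B ^+ n) <= _).
    have bnd k : (k <= n)%N -> M * K ^+ k * (N * L ^+ (n - k)) <= M * N * B ^+ n.
      move=> kn; rewrite mulrACA ler_wpM2l ?mulr_ge0 //.
      rewrite -[X in B ^+ X](subnKC kn) exprD.
      by apply: ler_pM; rewrite ?exprn_ge0 ?(ltW K0) ?(ltW L0).
    apply: le_trans (cabsD _ _) _.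
    rewrite -natr1 mulrDl mul1r lerD //.
      apply: le_trans (cabs_sum _ _ _) _.
      apply: le_trans (_ : \sum_(k < n) M * N * B ^+ n <= _); last first.
        by rewrite sumr_const card_ord mulr_natl.
      apply: ler_sum => k _.
      apply: le_trans (bnd k (ltnW (ltn_ord k))); rewrite cabsM.
      by rewrite ler_pM ?cabs_ge0 //; [have [] := FP k 0 w0r|have [] := GP (n - k)%N w ws].
    apply: le_trans (bnd n (leqnn _)); rewrite subnn cabsM.
    by rewrite ler_pM ?cabs_ge0 //; [have [] := FP n w wr|have [] := GP 0%N w ws].
  rewrite exprMn mulrCA ler_wpM2l ?mulr_ge0 // ler_wpM2r ?exprn_ge0 ?(ltW B0) //.
  by rewrite -natrX ler_nat ltn_expl.
- move=> w; rewrite lt_min => /andP[wr ws].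
  by rewrite gF // gG // /H big_ord0 add0r.
- move=> n; rewrite /H big_ord_recr subnn /= aF bG; congr (_ + _).
  by apply: eq_bigr => k _; rewrite aF bG.
Qed.

Lemma germ_scale c f p a : germ f p a -> germ (fun z => c * f z) p (fun n => c * a n).
Proof.
move=> /(germ_mul (germ_cst c p)); apply: germ_coef => n.
by rewrite big_ord_recl /= subn0 big1 ?addr0 // => i _; rewrite mul0r.
Qed.

Definition analytic f p := exists a, germ f p a.

Lemma germ_sum (I : Type) (s : seq I) (f : I -> C -> C) (a : I -> nat -> C) p :
  (forall i, germ (f i) p (a i)) ->
  germ (fun z => \sum_(i <- s) f i z) p (fun n => \sum_(i <- s) a i n).
Proof.
move=> fa; elim: s => [|i s IHs].
  apply: (germ_ext ltr01 _ (germ_coef _ (germ_cst 0 p))) => [w _|n].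
    by rewrite big_nil.
  by rewrite big_nil if_same.
apply: (germ_ext ltr01 _ (germ_coef _ (germ_add (fa i) IHs))) => [w _|n];
  by rewrite big_cons.
Qed.

Lemma analytic_cst c p : analytic (fun=> c) p.
Proof. by exists (fun n => if n == 0%N then c else 0); apply: germ_cst. Qed.

Lemma analytic_add f g p :
  analytic f p -> analytic g p -> analytic (fun z => f z + g z) p.
Proof. by move=> [a fa] [b gb]; eexists; apply: germ_add fa gb. Qed.

Lemma analytic_mul f g p :
  analytic f p -> analytic g p -> analytic (fun z => f z * g z) p.
Proof. by move=> [a fa] [b gb]; eexists; apply: germ_mul fa gb. Qed.

Lemma analytic_exp f p n : analytic f p -> analytic (fun z => f z ^+ n) p.
Proof.
move=> fp; elim: n => [|n IHn]; first exact: analytic_cst.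
have -> : (fun z => f z ^+ n.+1) = (fun z => f z * f z ^+ n).
  by apply/funext => z; rewrite exprS.
exact: analytic_mul.
Qed.

Lemma analytic_sum (I : Type) (s : seq I) (f : I -> C -> C) p :
  (forall i, analytic (f i) p) -> analytic (fun z => \sum_(i <- s) f i z) p.
Proof. by move=> /choice[a fa]; eexists; apply: germ_sum. Qed.

Lemma analytic_sub p : analytic (fun z => z - p) p.
Proof. by eexists; apply: germ_sub. Qed.

Lemma analytic_ext f g p (r : R) : 0 < r ->
  (forall w, cabs w < r -> f (p + w) = g (p + w)) -> analytic g p -> analytic f p.
Proof. by move=> r0 fg [a ga]; exists a; apply: germ_ext fg ga. Qed.

Lemma analytic_affine f c d p : c != 0 ->
  analytic f (c * p + d) -> analytic (fun z => f (c * z + d)) p.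
Proof.
move=> c0 [a [F [r [M [K [r0 K0 FP gF aF]]]]]].
have cc0 : 0 < cabs c by rewrite cabs_gt0.
exists (fun n => c ^+ n * a n), (fun n w => c ^+ n * F n (c * w)).
exists (r / cabs c), M, (cabs c * K).
have cr w : cabs w < r / cabs c -> cabs (c * w) < r.
  by rewrite cabsM ltr_pdivlMr // mulrC.
split; rewrite ?divr_gt0 ?mulr_gt0 //.
- move=> n w /cr wr; have [F1 F2] := FP n _ wr; split.
    by rewrite F1 mulr0 exprSr; ring.
  rewrite cabsM exprMn mulrCA cabsX ler_wpM2l ?exprn_ge0 ?(ltW cc0) //.
- by move=> w /cr wr; rewrite expr0 mul1r -gF // mulrDr addrAC.
- by move=> n; rewrite mulr0 aF.
Qed.

(** Dividing by [w ^+ m] is a re-indexing: the remainders of the quotient are those of [f] from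
    order [m] on. *)
Lemma germ_shift f p a m : germ f p a -> (forall k, (k < m)%N -> a k = 0) ->
  exists g (r : R), [/\ 0 < r, germ g p (fun n => a (m + n)%N) &
    forall w, cabs w < r -> f (p + w) = w ^+ m * g (p + w)].
Proof.
move=> [F [r [M [K [r0 K0 FP gF aF]]]]] am.
exists (fun z => F m (z - p)), r; split=> //.
  exists (fun n w => F (m + n)%N w), r, (M * K ^+ m), K; split=> //.
  - by move=> n w /(FP (m + n)%N)[F1 F2]; rewrite addnS -mulrA -exprD.
  - by move=> w _; rewrite addrC addKr addn0.
move=> w wr; rewrite [p + w]addrC addrK addrC gF //.
elim: m am => [|m IHm] am; first by rewrite expr0 mul1r.
rewrite IHm => [|k km]; last by apply: am; rewrite ltnS ltnW.
by have [-> _] := FP m w wr; rewrite -aF am // add0r exprSr mulrA.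
Qed.

Lemma germ_lipschitz f p a : germ f p a ->
  exists r B : R, [/\ 0 < r, 0 < B &
    forall w, cabs w < r -> cabs (f (p + w) - f p) <= B * cabs w].
Proof.
move=> fa; have fp := germ_val fa; move: fa => [F [r [M [K [r0 K0 FP gF aF]]]]].
have M0 := remainders_M_ge0 r0 FP.
exists r, (M * K + 1); split=> //.
  by rewrite ltr_wpDl // mulr_ge0 // ltW.
move=> w wr; rewrite fp gF //; have [-> _] := FP 0%N w wr.
rewrite -aF [_ + w * _]addrC addrK cabsM mulrC ler_wpM2r ?cabs_ge0 //.
by have [_] := FP 1%N w wr; rewrite expr1 => /le_trans; apply; rewrite lerDl.
Qed.

(** With all coefficients zero, [f (p + w) = w ^+ n * F n w] for every [n]; for [cabs w * K < 1/2]
    this is at most [M / 2 ^ n]. *)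
Lemma germ0_zero f p a : germ f p a -> (forall n, a n = 0) ->
  exists2 r : R, 0 < r & forall w, cabs w < r -> f (p + w) = 0.
Proof.
move=> [F [r [M [K [r0 K0 FP gF aF]]]]] a0.
have M0 := remainders_M_ge0 r0 FP.
exists (Num.min r (2^-1 / K)); first by rewrite lt_min r0 divr_gt0.
move=> w; rewrite lt_min ltr_pdivlMr // => /andP[wr wK].
have fE n : F 0%N w = w ^+ n * F n w.
  elim: n => [|n IHn]; first by rewrite expr0 mul1r.
  rewrite IHn; have [-> _] := FP n w wr.
  by rewrite -aF a0 add0r exprSr mulrA.
have le n : cabs (F 0%N w) <= M * 2^-1 ^+ n.
  rewrite (fE n) cabsM cabsX; have [_ /ler_wpM2l] := FP n w wr.
  move=> /(_ _ (exprn_ge0 n (cabs_ge0 w)))/le_trans; apply.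
  rewrite mulrCA -exprMn ler_wpM2l // lerXn2r ?nnegrE ?mulr_ge0 ?cabs_ge0 ?ltW //.
rewrite gF //; apply/eqP; rewrite -cabs_eq0 eq_le cabs_ge0 andbT.
apply/ler_addgt0Pr => e e0; rewrite add0r.
have [M00|Mn0] := eqVneq M 0.
  by have := le 0%N; rewrite M00 mul0r => /le_trans; apply; apply: ltW.
have Mp : 0 < M by rewrite lt_neqAle eq_sym Mn0.
pose N := Num.bound (M / e).
have MN : M / e < N%:R by apply: archi_boundP; rewrite divr_ge0 // ltW.
apply: le_trans (le N) _; rewrite exprVn ler_pdivrMr ?exprn_gt0 //.
rewrite ltr_pdivrMr // in MN; apply: le_trans (ltW MN) _.
by rewrite mulrC ler_pM2l // -natrX ler_nat ltnW // ltn_expl.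
Qed.

(** Control of the leading term, from which both the isolation of zeros and the maximum principle
    follow. *)
Lemma germ_first f p a m : germ f p a -> (forall k, (k < m)%N -> a k = 0) ->
  a m != 0 -> exists (g : C -> C) (r B : R), [/\ 0 < r, 0 < B,
    forall w, cabs w < r -> f (p + w) = w ^+ m * g (p + w) &
    forall w, cabs w < r -> cabs (g (p + w) - a m) <= B * cabs w].
Proof.
move=> fa am am0; have [g [r [r0 gg fg]]] := germ_shift fa am.
have [s [B [s0 B0 gB]]] := germ_lipschitz gg.
have gp := germ_val gg; rewrite addn0 in gp; rewrite gp in gB.
exists g, (Num.min r s), B; split; rewrite ?lt_min ?r0 //.
  by move=> w; rewrite lt_min => /andP[wr _]; apply: fg.
by move=> w; rewrite lt_min => /andP[_ ws]; apply: gB.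
Qed.

Lemma analytic_dichotomy f p : analytic f p ->
  (exists2 r : R, 0 < r & forall w, cabs w < r -> f (p + w) = 0) \/
  (exists2 r : R, 0 < r & forall w, w != 0 -> cabs w < r -> f (p + w) != 0).
Proof.
move=> [a fa]; have [a0|] := pselect (forall n, a n = 0).
  by left; apply: germ0_zero fa a0.
move=> /existsNP[n0 /eqP n0P]; right.
have exa : exists n, a n != 0 by exists n0.
case: (ex_minnP exa) => m am mP.
have am' k : (k < m)%N -> a k = 0.
  by move=> km; apply/eqP/negPn/negP => /mP; rewrite leqNgt km.
have [g [r [B [r0 B0 fg gB]]]] := germ_first fa am' am.
exists (Num.min r (cabs (a m) / B)).
  by rewrite lt_min r0 divr_gt0 // cabs_gt0.
move=> w w0; rewrite lt_min ltr_pdivlMr // => /andP[wr wB].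
rewrite fg // mulf_neq0 ?expf_neq0 //; apply/eqP => g0.
have := gB w wr; rewrite g0 sub0r cabsN leNgt mulrC => /negP; exact.
Qed.

Lemma analytic_max f p (r : R) : analytic f p -> 0 < r ->
  (forall w, cabs w < r -> cabs (f (p + w)) <= cabs (f p)) ->
  exists2 s : R, 0 < s & forall w, cabs w < s -> f (p + w) = f p.
Proof.
move=> [a0 fa] r0 fmax; have [fp0|fp0] := eqVneq (f p) 0.
  exists r => // w /fmax; rewrite fp0 cabs0 => h; apply/eqP.
  by rewrite -cabs_eq0 eq_le h cabs_ge0.
have := germ_add fa (germ_cst (- f p) p).
set a := (X in germ _ _ X) => ha.
have a00 : a 0%N = 0 by rewrite /a /= (germ_val fa) subrr.
have [az|] := pselect (forall n, a n = 0).
  have [s s0 sP] := germ0_zero ha az; exists s => // w ws.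
  by apply/eqP; rewrite -subr_eq0 sP.
move=> /existsNP[n0 /eqP n0P].
have exa : exists n, a n != 0 by exists n0.
case: (ex_minnP exa) => m am mP.
have am' k : (k < m)%N -> a k = 0.
  by move=> km; apply/eqP/negPn/negP => /mP; rewrite leqNgt km.
have m0 : (0 < m)%N by case: m am {mP am'} => //; rewrite a00 eqxx.
have [g [s [B [s0 B0 fg gB]]]] := germ_first ha am' am.
(* In this direction the leading term [a m * w ^+ m] is a positive multiple of [f p], hence
   increases the modulus. *)
pose zeta : C := m.-root (f p / a m).
have zetaE : zeta ^+ m = f p / a m by rewrite rootCK.
have z0 : zeta != 0.
  apply/eqP => z0; move: zetaE; rewrite z0 expr0n gtn_eqF // => /esym/eqP.
  by rewrite mulf_eq0 invr_eq0 (negbTE fp0) (negbTE am).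
have cz0 : 0 < cabs zeta by rewrite cabs_gt0.
have cf0 : 0 < cabs (f p) by rewrite cabs_gt0.
(* At [w = t * zeta] the error is at most [t ^+ m * (t * D)] and the gain is [t ^+ m * cabs (f p)],
   so [t * D < cabs (f p)] contradicts maximality. *)
pose D := cabs zeta ^+ m.+1 * B.
have D0 : 0 < D by rewrite mulr_gt0 ?exprn_gt0.
pose y := Num.min (Num.min r s / cabs zeta) (cabs (f p) / D).
have y0 : 0 < y by rewrite lt_min !divr_gt0 // lt_min r0.
pose t := y / 2.
have t0 : 0 < t by rewrite divr_gt0.
have [tr ts tD] : [/\ t * cabs zeta < r, t * cabs zeta < s & t * D < cabs (f p)].
  have : t < y by rewrite /t; lra.
  by rewrite lt_min !ltr_pdivlMr // lt_min => /andP[/andP[]].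
pose w : C := t%:C%C * zeta.
have cw : cabs w = t * cabs zeta by rewrite cabsM cabs_real gtr0_norm.
have wm : w ^+ m = t%:C%C ^+ m * (f p / a m) by rewrite exprMn zetaE.
have := fmax w; rewrite cw => /(_ tr).
have := gB w; have := fg w; rewrite cw => /(_ ts) fw /(_ ts) gw.
have -> : f (p + w) = f p * (1 + t%:C%C ^+ m) + w ^+ m * (g (p + w) - a m).
  move: fw => /(canRL (addrNK _)) ->.
  by rewrite wm; field.
have h1 : cabs (1 + t%:C%C ^+ m) = 1 + t ^+ m.
  by rewrite -rmorphXn -(rmorph1 (real_complex R)) -rmorphD cabs_real
    ger0_norm // addr_ge0 // exprn_ge0 // ltW.
move=> h; have := le_trans (cabs_lb _ _) h.
rewrite cabsM h1 cabsM cabsX cw => {}h.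
have tm0 : 0 < t ^+ m by rewrite exprn_gt0.
have : (t * cabs zeta) ^+ m * cabs (g (p + w) - a m) <=
   t ^+ m * (t * D).
  rewrite exprMn -mulrA ler_pM2l // /D exprSr.
  apply: le_trans (ler_wpM2l (exprn_ge0 m (ltW cz0)) gw) _.
  by rewrite le_eqVlt; apply/orP; left; apply/eqP; ring.
have : t ^+ m * (t * D) < t ^+ m * cabs (f p) by rewrite ltr_pM2l.
lra.
Qed.

End Germs.

(** * Meromorphic functions and the identity theorem *)

Section Meromorphic.
Variable R : realType.
Local Notation C := (Cplx R).
Implicit Types (f g : C -> C) (p c z w : C).

Definition punctured p (Q : C -> Prop) :=
  exists2 r : R, 0 < r & forall w, w != 0 -> cabs w < r -> Q (p + w).

Lemma puncturedI p (Q Q' : C -> Prop) :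
  punctured p Q -> punctured p Q' -> punctured p (fun z => Q z /\ Q' z).
Proof.
move=> [r r0 rQ] [s s0 sQ]; exists (Num.min r s); first by rewrite lt_min r0.
by move=> w w0; rewrite lt_min => /andP[wr ws]; split; [apply: rQ|apply: sQ].
Qed.

Lemma punctured_sub p (Q Q' : C -> Prop) :
  (forall z, Q z -> Q' z) -> punctured p Q -> punctured p Q'.
Proof. by move=> QQ [r r0 rQ]; exists r => // w w0 wr; apply/QQ/rQ. Qed.

Lemma punctured_ex p (Q : C -> Prop) : punctured p Q -> exists z, Q z.
Proof.
move=> [r r0 rQ]; exists (p + (r / 2)%:C%C); apply: rQ.
  by rewrite -cabs_gt0 cabs_real normr_gt0 lt0r_neq0 // divr_gt0.
by rewrite cabs_real gtr0_norm ?divr_gt0 //; lra.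
Qed.

Lemma punctured_open p (Q : C -> Prop) : punctured p Q ->
  exists2 r : R, 0 < r & forall d, cabs d < r -> punctured (p + d) Q.
Proof.
move=> [r r0 rQ]; exists r => // d dr; have [->|d0] := eqVneq d 0.
  by exists r => // w w0 wr; rewrite addr0; apply: rQ.
exists (Num.min (cabs d) (r - cabs d)).
  by rewrite lt_min cabs_gt0 d0 subr_gt0.
move=> w w0; rewrite lt_min => /andP[wd wr]; rewrite -addrA; apply: rQ.
  apply/eqP => /eqP; rewrite addr_eq0 => /eqP dw.
  by move: wd; rewrite dw cabsN ltxx.
by apply: le_lt_trans (cabsD _ _) _; rewrite addrC -ltrBrDr.
Qed.

(** On the segment from [p] to [q] the parameters satisfying either alternative form an open set,
    and the two sets are complementary, so connectedness of [[0, 1]] decides. Working with punctured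
    discs lets the segment run through poles and isolated zeros. *)
Lemma identity_theorem f p q :
  (forall z, punctured z (fun z => f z = 0) \/ punctured z (fun z => f z != 0)) ->
  punctured p (fun z => f z = 0) -> punctured q (fun z => f z = 0).
Proof.
move=> fdich fp0; pose gam (t : R) : C := p + t%:C%C * (q - p).
pose Z (Q : C -> Prop) : set R := [set t | punctured (gam t) Q].
have Zopen Q : open (Z Q).
  rewrite openE => t /punctured_open[r r0 rQ]; apply/nbhs_ballP.
  exists (r / (cabs (q - p) + 1)) => /=.
    by rewrite divr_gt0 // ltr_wpDl // cabs_ge0.
  move=> s; rewrite /ball /= ltr_pdivlMr ?ltr_wpDl ?cabs_ge0 // => ts.
  change (punctured (gam s) Q).
  have -> : gam s = gam t + (s - t)%:C%C * (q - p) by rewrite /gam rmorphB /=; ring.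
  apply: rQ; rewrite cabsM cabs_real distrC; apply: le_lt_trans ts.
  by rewrite ler_wpM2l // lerDl.
have ZC : Z (fun z => f z = 0) = ~` Z (fun z => f z != 0).
  apply/seteqP; split=> t /= h.
    move=> h'; have [z [-> ]] := punctured_ex (puncturedI h h'); by rewrite eqxx.
  by have [//|/h] := fdich (gam t).
have B1 : `[0, 1]%classic `&` Z (fun z => f z = 0) = `[(0 : R), 1]%classic.
  apply: (@segment_connected R 0 1).
  - exists 0; split; first by rewrite /= in_itv /= lexx ler01.
    by rewrite /Z /= /gam mul0r addr0.
  - by exists (Z (fun z => f z = 0)).
  - by exists (Z (fun z => f z = 0)) => //; rewrite ZC; apply: open_closedC.
have : `[(0 : R), 1]%classic 1 by rewrite /= in_itv /= ler01 lexx.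
rewrite -B1 => -[_]; rewrite /Z /= /gam mul1r.
by rewrite addrC subrK.
Qed.

(** The value of [f] at [p] is left free, which accommodates the default values at poles. *)
Definition mero f p := exists (g : C -> C) (n : nat), analytic g p /\
  punctured p (fun z => f z * (z - p) ^+ n = g z).

Lemma mero_analytic f p : analytic f p -> mero f p.
Proof.
by exists f, 0%N; split=> //; exists 1 => // w _ _; rewrite expr0 mulr1.
Qed.

Lemma mero_mul f g p : mero f p -> mero g p -> mero (fun z => f z * g z) p.
Proof.
move=> [F [m [Fa Fp]]] [G [n [Ga Gp]]]; exists (fun z => F z * G z), (m + n)%N.
split; first exact: analytic_mul.
apply: punctured_sub (puncturedI Fp Gp) => z [<- <-].
by rewrite exprD mulrACA.
Qed.

Lemma mero_add f g p : mero f p -> mero g p -> mero (fun z => f z + g z) p.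
Proof.
move=> [F [m [Fa Fp]]] [G [n [Ga Gp]]].
exists (fun z => F z * (z - p) ^+ n + G z * (z - p) ^+ m), (m + n)%N; split.
  by apply: analytic_add; apply: analytic_mul => //;
    apply: analytic_exp; apply: analytic_sub.
apply: punctured_sub (puncturedI Fp Gp) => z [<- <-].
by rewrite exprD; ring.
Qed.

Lemma mero_exp f p n : mero f p -> mero (fun z => f z ^+ n) p.
Proof.
move=> fp; elim: n => [|n IHn]; first exact/mero_analytic/analytic_cst.
have -> : (fun z => f z ^+ n.+1) = (fun z => f z * f z ^+ n).
  by apply/funext => z; rewrite exprS.
exact: mero_mul.
Qed.

Lemma mero_sum (I : Type) (s : seq I) (f : I -> C -> C) p :
  (forall i, mero (f i) p) -> mero (fun z => \sum_(i <- s) f i z) p.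
Proof.
move=> fp; elim: s => [|i s IHs].
  have -> : (fun z => \sum_(i <- [::]) f i z) = (fun=> 0).
    by apply/funext => z; rewrite big_nil.
  exact/mero_analytic/analytic_cst.
have -> : (fun z => \sum_(i <- i :: s) f i z) =
          (fun z => f i z + \sum_(i <- s) f i z).
  by apply/funext => z; rewrite big_cons.
exact: mero_add.
Qed.

Lemma mero_dichotomy f p : mero f p ->
  punctured p (fun z => f z = 0) \/ punctured p (fun z => f z != 0).
Proof.
move=> [g [n [/analytic_dichotomy[] [r r0 rg] fg]]]; [left|right].
  have gz : punctured p (fun z => g z = 0 /\ z - p != 0).
    by exists r => // w w0 wr; split; [apply: rg|rewrite addrC addKr].
  apply: punctured_sub (puncturedI fg gz) => z [fz [gz0 z0]].
  by apply/eqP; move/eqP: fz; rewrite gz0 mulf_eq0 expf_eq0 (negbTE z0) andbF orbF.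
have gz : punctured p (fun z => g z != 0).
  by exists r => // w w0 wr; apply: rg.
apply: punctured_sub (puncturedI fg gz) => z [fz]; apply: contraNneq.
by move=> f0; rewrite -fz f0 mul0r.
Qed.

Lemma analytic_punctured_eq0 f p : analytic f p ->
  punctured p (fun z => f z = 0) -> f p = 0.
Proof.
move=> fp f0; have [[r r0 rf]|[r r0 rf]] := analytic_dichotomy fp.
  by rewrite -(addr0 p) rf // cabs0.
have fn : punctured p (fun z => f z != 0) by exists r.
by have [z [->]] := punctured_ex (puncturedI f0 fn); rewrite eqxx.
Qed.

End Meromorphic.

(** * Doubly periodic functions *)

Section Periodic.
Variable R : realType.
Local Notation C := (Cplx R).
Implicit Types (f g : C -> C) (p c z : C).
Variable w : C.

Lemma lattice_coord z : w \isn't Num.real ->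
  exists s t : R, z = s%:C%C + t%:C%C * w.
Proof.
move=> /nonreal_Im wI; exists (complex.Re z - complex.Im z / complex.Im w * complex.Re w).
exists (complex.Im z / complex.Im w).
case: z w wI => [a b] [c d] /= d0; apply/eqP; rewrite eq_complex /=.
by apply/andP; split; apply/eqP; field.
Qed.

Definition lattice_periodic f := forall z, f (z + 1) = f z /\ f (z + w) = f z.

Lemma periodic_lattice f : lattice_periodic f ->
  forall (p : int * int) z, f (z + lattice_pt w p) = f z.
Proof.
move=> fper [m n] z; rewrite /lattice_pt /= addrA.
have per d : (forall z, f (z + d) = f z) ->
    forall (k : int) (z : C), f (z + k%:~R * d) = f z.
  move=> fd; elim=> [|k IHk|k IHk] y; first by rewrite mul0r addr0.
    by rewrite -addn1 PoszD intrD mulrDl mul1r addrA fd.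
  rewrite -[RHS](IHk y) -[LHS]fd; congr f; rewrite -addn1 PoszD opprD intrD.
  by rewrite mulrDl mulN1r addrA subrK.
have := per 1 (fun y => (fper y).1) m z; rewrite mulr1 => <-.
exact: (per w (fun y => (fper y).2)).
Qed.

Lemma frac_coord z : w \isn't Num.real ->
  exists (p : int * int) (s t : R),
    [/\ 0 <= s < 1, 0 <= t < 1 & z = s%:C%C + t%:C%C * w + lattice_pt w p].
Proof.
move=> /(lattice_coord z)[s [t ->]].
have fracP (x : R) : 0 <= x - (Num.floor x)%:~R < 1.
  have /andP[h1 h2] := floor_itv x; rewrite intrD in h2.
  by rewrite subr_ge0 h1 ltrBlDl.
exists (Num.floor s, Num.floor t), (s - (Num.floor s)%:~R), (t - (Num.floor t)%:~R).
split=> //; rewrite /lattice_pt /= !rmorphB /= !rmorph_int; ring.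
Qed.

(** The modulus attains a maximum over a period parallelogram, which is a maximum over the plane by
    periodicity. Then [f] is constant near that point by the maximum principle, and everywhere by
    the identity theorem. *)
Lemma liouville f : w \isn't Num.real -> (forall z, analytic f z) ->
  lattice_periodic f -> forall z, f z = f 0.
Proof.
move=> wnr fan fper.
pose h (x : R * R) : R := cabs (f (x.1%:C%C + x.2%:C%C * w)).
have hcont : continuous h.
  move=> [s t]; apply/cvgrPdist_lt => e e0.
  set p := s%:C%C + t%:C%C * w.
  have [a /germ_lipschitz[r [B [r0 B0 fB]]]] := fan p.
  pose D := cabs w + 1.
  have D0 : 0 < D by rewrite ltr_wpDl // cabs_ge0.
  (* Changing both real coordinates by less than [d] moves the point by less than [2 * d * D]. *)
  pose d := Num.min r (e / B) / (2 * D).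
  have d0 : 0 < d by rewrite divr_gt0 ?mulr_gt0 // lt_min r0 divr_gt0.
  exists (ball s d, ball t d).
    by split; apply: nbhsx_ballx.
  move=> [s' t'] [/= ss' tt'].
  rewrite /ball /= in ss' tt'.
  pose q : C := (s' - s)%:C%C + (t' - t)%:C%C * w.
  have pq : s'%:C%C + t'%:C%C * w = p + q by rewrite /p /q !rmorphB /=; ring.
  have cq : cabs q < Num.min r (e / B).
    apply: le_lt_trans (cabsD _ _) _; rewrite cabsM !cabs_real.
    have : Num.min r (e / B) = d * D + d * D by rewrite /d; field; rewrite lt0r_neq0.
    move=> ->; rewrite distrC in ss'; rewrite distrC in tt'; apply: ltr_leD.
      by apply: lt_le_trans ss' _; rewrite ler_peMr ?(ltW d0) // lerDr cabs_ge0.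
    by apply: ler_pM; rewrite ?cabs_ge0 ?(ltW tt') // lerDl.
  move: cq; rewrite lt_min ltr_pdivlMr // => /andP[/fB fq qB].
  rewrite /h /= pq -/p.
  have h1 := cabs_lb (f (p + q) - f p) (f p).
  have h2 := cabsD (f (p + q) - f p) (f p).
  have h3 := cabsD (- (f (p + q) - f p)) (f (p + q)).
  rewrite cabsN opprB subrK in h3; rewrite subrK in h2.
  rewrite ltr_norml; apply/andP; split; lra.
have [|||[s0 t0] _ hmax] := @compact_EVT_max _ R h (`[0, 1] `*` `[0, 1]).
- by exists (0, 0); split; rewrite /= in_itv /= lexx ler01.
- by apply: compact_setX; apply: segment_compact.
- exact: continuous_subspaceT.
pose z0 : C := s0%:C%C + t0%:C%C * w.
have fmax z : cabs (f z) <= cabs (f z0).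
  have [p [s [t [/andP[s1 s2] /andP[t1 t2] ->]]]] := frac_coord z wnr.
  rewrite periodic_lattice //; apply: (hmax (s, t)).
  by apply: mem_set; split; rewrite /= in_itv /= ?s1 ?t1 ltW.
have [r r0 fr] := analytic_max (fan z0) ltr01 (fun d _ => fmax (z0 + d)).
have fan' z : analytic (fun z => f z - f z0) z.
  by apply: analytic_add => //; apply: analytic_cst.
have f0 z : f z - f z0 = 0.
  apply: (analytic_punctured_eq0 (fan' z)).
  apply: (@identity_theorem R _ z0) => [q|].
    by apply: mero_dichotomy; apply: mero_analytic.
  by exists r => // d _ dr; rewrite fr // subrr.
by move=> z; rewrite (subr0_eq (f0 z)) (subr0_eq (f0 0)).
Qed.

End Periodic.

(** * Algebraic dependence of functions with common periods *)

Section Siegel.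
Variable R : realType.
Local Notation C := (Cplx R).
Implicit Types (f g : C -> C) (p z : C).
Variable w : C.

(** The order is at most 2, and regular points qualify; thus one list of points can serve two
    functions with different poles. *)
Definition double_pole f p := exists2 g, analytic g p &
  punctured p (fun z => f z * (z - p) ^+ 2 = g z).

Lemma double_pole_exp f p n : double_pole f p ->
  exists2 g, analytic g p & punctured p (fun z => f z ^+ n * (z - p) ^+ (2 * n) = g z).
Proof.
move=> [g ga gf]; exists (fun z => g z ^+ n); first exact: analytic_exp.
by apply: punctured_sub gf => z <-; rewrite exprMn exprM.
Qed.

(** The exponent [4 * n] is the same for all monomials, so that their combinations can be expanded
    together. *)
Lemma double_pole_monomial f g p n i j : (i <= n)%N -> (j <= n)%N ->
  double_pole f p -> double_pole g p ->
  exists2 h, analytic h p &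
    punctured p (fun z => f z ^+ i * g z ^+ j * (z - p) ^+ (4 * n) = h z).
Proof.
move=> il jl /(double_pole_exp i)[F Fa Ff] /(double_pole_exp j)[G Ga Gg].
exists (fun z => F z * G z * (z - p) ^+ (2 * (n - i) + 2 * (n - j))).
  do 2?[apply: analytic_mul => //]; apply: analytic_exp; exact: analytic_sub.
apply: punctured_sub (puncturedI Ff Gg) => z [<- <-].
have -> : (4 * n = 2 * i + 2 * j + (2 * (n - i) + 2 * (n - j)))%N by lia.
by rewrite [in LHS]exprD [X in _ * (X * _)]exprD; ring.
Qed.

(* Siegel's lemma: among the monomials [x ^+ i * y ^+ j], [i, j <= n], there are
   more than there are linear conditions for a combination to be regular and to
   vanish at the poles. *)
Lemma periodic_algebraic (x y : C -> C) (S : C -> Prop) (L : seq C) :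
  w \isn't Num.real -> lattice_periodic w x -> lattice_periodic w y ->
  (forall k z, S (z + lattice_pt w k) <-> S z) ->
  (0 < size L)%N -> (forall p, p \in L -> S p) ->
  (forall p, S p -> exists k, p + lattice_pt w k \in L) ->
  (forall p, ~ S p -> analytic x p /\ analytic y p) ->
  (forall p, punctured p (fun z => ~ S z)) ->
  (forall p, p \in L -> double_pole x p /\ double_pole y p) ->
  exists2 P : {poly {poly C}}, P != 0 &
    forall z, ~ S z -> P.[(y z)%:P].[x z] = 0.
Proof.
move=> wnr xper yper Sper L0 LS SL regS Siso polL.
(* There are [(n + 1) ^ 2] unknown coefficients and [m * (N + 1) = n ^ 2 + m] conditions, which is
   fewer since [m <= n]. *)
pose m := size L; pose n := (4 * m)%N; pose N := (4 * n)%N.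
pose mono (i : 'I_n.+1 * 'I_n.+1) z := x z ^+ i.1 * y z ^+ i.2.
pose pt (l : 'I_m) := L`_l.
have ptL l : pt l \in L by rewrite mem_nth.
have /choice[ga gaP] : forall li : 'I_m * ('I_n.+1 * 'I_n.+1),
    exists ga : (C -> C) * (nat -> C), germ ga.1 (pt li.1) ga.2 /\
      punctured (pt li.1) (fun z => mono li.2 z * (z - pt li.1) ^+ N = ga.1 z).
  move=> [l [i j]]; have [px py] := polL _ (ptL l).
  have [h [a ha] hP] := @double_pole_monomial _ _ _ n i j (ltn_ord i) (ltn_ord j) px py.
  by exists (h, a).
(* At each pole, the coefficients of orders below [N] cancel the polar part, and the one of order
   [N] makes the combination vanish there. *)
have [] := @kernel_exists C _ _
  (fun i (lk : 'I_m * 'I_N.+1) => (ga (lk.1, i)).2 lk.2).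
  rewrite !card_prod !card_ord /N /n; lia.
move=> c [c0 cker]; exists (bipoly c); first exact: bipoly_neq0.
pose F z := \sum_i c i * mono i z.
suff F0 : forall z, ~ S z -> F z = 0 by move=> z /F0; rewrite bipoly_eval.
(* The default values of [x] and [y] on [S] are replaced by the value 0 that the vanishing
   conditions force. *)
pose F' z := if `[< S z >] then 0 else F z.
have F'S z : S z -> F' z = 0 by rewrite /F'; case: asboolP.
have F'N z : ~ S z -> F' z = F z by rewrite /F'; case: asboolP.
have Fl l : exists2 g, analytic g (pt l) &
    punctured (pt l) (fun z => F z = (z - pt l) * g z).
  have := @germ_sum R _ (index_enum _) (fun i z => c i * (ga (l, i)).1 z)
    (fun i k => c i * (ga (l, i)).2 k) (pt l) (fun i => germ_scale _ (gaP (l, i)).1).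
  set G := (X in germ X) => Ga.
  have [k kN|g [r [r0 ga' gE]]] := @germ_shift _ _ _ _ N.+1 Ga.
    exact: (cker (l, Ordinal kN)).
  exists g; first by eexists; exact: ga'.
  have FG : punctured (pt l) (fun z => F z * (z - pt l) ^+ N = G z).
    rewrite /F /G; elim: (index_enum _) => [|i s IHs].
      by exists 1 => // d _ _; rewrite !big_nil mul0r.
    apply: punctured_sub (puncturedI IHs (gaP (l, i)).2) => z /= [h1 h2].
    by rewrite !big_cons mulrDl -h1 -h2 !mulrA.
  have gE' : punctured (pt l) (fun z => G z = (z - pt l) ^+ N.+1 * g z /\ z - pt l != 0).
    by exists r => // d d0 dr; rewrite (gE d dr) [_ + d - _]addrC addKr.
  apply: punctured_sub (puncturedI FG gE') => z [h1 [h2 z0]].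
  apply: (mulIf (expf_neq0 N z0)); rewrite h1 h2 exprS; ring.
have F'l l : analytic F' (pt l).
  have [g ga' gF] := Fl l.
  have [r r0 rP] := puncturedI gF (Siso (pt l)).
  apply: (@analytic_ext _ _ (fun z => (z - pt l) * g z) _ r r0) => [d dr|].
    have [->|d0] := eqVneq d 0.
      by rewrite addr0 subrr mul0r F'S //; apply/LS/ptL.
    by have [<- ?] := rP d d0 dr; rewrite F'N.
  by apply: analytic_mul => //; apply: analytic_sub.
have F'lat k z : F' (z + lattice_pt w k) = F' z.
  have [Sz|Sz] := pselect (S z); first by rewrite !F'S ?Sper.
  rewrite !F'N ?Sper //; apply: eq_bigr => i _.
  by rewrite /mono !(periodic_lattice _ k).
have F'per : lattice_periodic w F'.
  move=> z; split; [have := F'lat (1, 0) z|have := F'lat (0, 1) z];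
    rewrite /lattice_pt /=.
    by rewrite mul0r addr0.
  by rewrite mul1r add0r.
have F'an z : analytic F' z.
  have [Sz|Sz] := pselect (S z).
    have [k /(nthP 0)[l lL lE]] := SL z Sz.
    have -> : F' = (fun u => F' (1 * u + lattice_pt w k)).
      by apply/funext => u; rewrite mul1r F'lat.
    apply: analytic_affine; first exact: oner_neq0.
    rewrite mul1r -lE; exact: (F'l (Ordinal lL)).
  have [r r0 rS] := Siso z.
  apply: (@analytic_ext _ _ F _ r r0) => [d dr|].
    by rewrite F'N //; have [->|d0] := eqVneq d 0; [rewrite addr0|apply: rS].
  apply: analytic_sum => i; have [xa ya] := regS z Sz.
  apply: analytic_mul; first exact: analytic_cst.
  by apply: analytic_mul; apply: analytic_exp.
(* The constant given by Liouville's theorem is read off at a pole, and [L] contains one. *)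
have F'0 z : F' z = 0.
  rewrite (liouville wnr F'an F'per) -(liouville wnr F'an F'per L`_0).
  by rewrite F'S //; apply/LS/mem_nth.
by move=> z Sz; rewrite -F'N.
Qed.

End Siegel.

(** * Unordered sums *)

#[local] Existing Instance totally_filter.

Section UnorderedSums.
Variables (R : realType) (I : choiceType).
Local Notation C := (Cplx R).
Implicit Types (J : {fset I}).

Lemma partial_sumE (V : zmodType) (f : I -> V) J :
  partial_sum f J = \sum_(k <- J) f k.
Proof. by rewrite /partial_sum big_seq_fsetE. Qed.

Lemma partial_sum_le (f : I -> R) J J' : (forall k, 0 <= f k) -> (J `<=` J')%fset ->
  partial_sum f J <= partial_sum f J'.
Proof.
move=> f0 JJ'; rewrite !partial_sumE (big_fsetID _ (mem J) J') /=.
have -> : [fset x in J' | x \in J]%fset = J.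
  apply/fsetP => x; rewrite !inE /= andbC; case: (boolP (x \in J)) => //= xJ.
  exact: (fsubsetP JJ').
by rewrite lerDl sumr_ge0.
Qed.

(** Bounded finite partial sums are what a comparison yields directly; for nonnegative families this
    is summability. *)
Definition majorant (g : I -> R) :=
  (forall k, 0 <= g k) /\ exists B : R, forall J, partial_sum g J <= B.

Lemma majorant_scale (c : R) g : 0 <= c -> majorant g -> majorant (fun k => c * g k).
Proof.
move=> c0 [g0 [B gB]]; split=> [k|]; first by rewrite mulr_ge0.
exists (c * B) => J; rewrite partial_sumE -mulr_sumr -partial_sumE.
by rewrite ler_wpM2l.
Qed.

Lemma nonneg_sum_cvg (f g : I -> R) : majorant g ->
  (forall k, 0 <= f k <= g k) -> exists l : R, partial_sum f @ totally --> l.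
Proof.
move=> [g0 [B gB]] fg.
pose E := range (partial_sum f).
have f0 k : 0 <= f k by case/andP: (fg k).
have supE : has_sup E.
  split; first by exists (partial_sum f fset0), fset0.
  exists B => _ [J _ <-]; apply: le_trans (gB J); rewrite !partial_sumE.
  by apply: ler_sum => k _; case/andP: (fg k).
exists (sup E); apply/cvgrPdist_lt => e e0.
have [_ [J0 _ <-] J0e] := sup_adherent e0 supE.
exists J0 => // J /= J0J.
have h1 := partial_sum_le f0 J0J.
have h2 : partial_sum f J <= sup E by apply: ub_le_sup; [case: supE|exists J].
rewrite ger0_norm ?subr_ge0 //; rewrite ltrBlDl -ltrBlDr.
exact: lt_le_trans J0e h1.
Qed.

(** Signs are removed by writing [f = (f + g) - g] with [0 <= f + g <= 2 * g]. *)
Lemma real_sum_cvg (f g : I -> R) : majorant g ->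
  (forall k, `|f k| <= g k) -> exists l : R, partial_sum f @ totally --> l.
Proof.
move=> mg fg.
have [|l1 cl1] := @nonneg_sum_cvg (fun k => f k + g k) _ (majorant_scale (ler0n _ 2) mg).
  move=> k; have := fg k; rewrite ler_norml => /andP[h1 h2].
  by apply/andP; split; lra.
have [|l2 cl2] := @nonneg_sum_cvg g _ mg.
  by move=> k; rewrite lexx andbT; case: mg.
exists (l1 - l2).
have -> : partial_sum f = (fun J => partial_sum (fun k => f k + g k) J - partial_sum g J).
  apply/funext => J; rewrite !partial_sumE -sumrB.
  by apply: eq_bigr => k _; rewrite addrK.
exact: cvgB cl1 cl2.
Qed.

Lemma partial_sum_Re (f : I -> C) J :
  complex.Re (partial_sum f J) = partial_sum (fun k => complex.Re (f k)) J.
Proof. by rewrite !partial_sumE (big_morph _ (@cRe_add R) (erefl : complex.Re 0 = 0)). Qed.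

Lemma partial_sum_Im (f : I -> C) J :
  complex.Im (partial_sum f J) = partial_sum (fun k => complex.Im (f k)) J.
Proof. by rewrite !partial_sumE (big_morph _ (@cIm_add R) (erefl : complex.Im 0 = 0)). Qed.

Definition dominated (g : I -> R) (f : I -> C) :=
  exists M : R, forall k, cabs (f k) <= M * g k.

Lemma dominated_le (g : I -> R) (f h : I -> C) :
  (forall k, cabs (f k) <= cabs (h k)) -> dominated g h -> dominated g f.
Proof. by move=> fh [M hM]; exists M => k; apply: le_trans (fh k) _. Qed.

Lemma sum_cvg (f : I -> C) g : majorant g -> dominated g f ->
  partial_sum f @ totally --> sum f.
Proof.
move=> mg [M fM].
have mMg : majorant (fun k => `|M| * g k) by apply: majorant_scale.
have fM' k : cabs (f k) <= `|M| * g k.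
  by apply: le_trans (fM k) _; rewrite ler_wpM2r ?ler_norm //; case: mg.
have [|lr clr] := @real_sum_cvg (fun k => complex.Re (f k)) _ mMg.
  by move=> k; apply: le_trans (fM' k); apply: cabs_Re.
have [|li cli] := @real_sum_cvg (fun k => complex.Im (f k)) _ mMg.
  by move=> k; apply: le_trans (fM' k); apply: cabs_Im.
have fl : partial_sum f @ totally --> ((lr +i* li)%C : C).
  apply/cvg_cabs => e e0; have e20 : 0 < e / 2 by rewrite divr_gt0.
  move/cvgrPdist_lt: clr => /(_ _ e20); move/cvgrPdist_lt: cli => /(_ _ e20).
  apply: filterS2 => J h1 h2; apply: le_lt_trans (cabs_le_ReIm _) _.
  have -> : complex.Re (partial_sum f J - (lr +i* li)%C) =
            partial_sum (fun k => complex.Re (f k)) J - lr.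
    by rewrite -partial_sum_Re; case: (partial_sum f J).
  have -> : complex.Im (partial_sum f J - (lr +i* li)%C) =
            partial_sum (fun k => complex.Im (f k)) J - li.
    by rewrite -partial_sum_Im; case: (partial_sum f J).
  by rewrite distrC in h1; rewrite distrC in h2; rewrite (splitr e) ltrD.
by rewrite /sum (cvg_lim _ fl) //; apply: norm_hausdorff.
Qed.

Lemma sum_unique (f : I -> C) (l : C) :
  partial_sum f @ totally --> l -> sum f = l.
Proof. by move=> fl; rewrite /sum (cvg_lim _ fl) //; apply: norm_hausdorff. Qed.

Lemma sum_lin (f h : I -> C) (c : C) g : majorant g -> dominated g f ->
  dominated g h -> sum (fun k => f k + c * h k) = sum f + c * sum h.
Proof.
move=> mg df dh; apply: sum_unique.
have -> : partial_sum (fun k => f k + c * h k) =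
    (fun J => partial_sum f J + c * partial_sum h J).
  apply/funext => J; rewrite !partial_sumE mulr_sumr -big_split /=.
  exact: eq_bigr.
apply: cvgD; first exact: sum_cvg df.
by apply: cvgMr; apply: sum_cvg dh.
Qed.

Lemma sum_le (f : I -> C) g (M B : R) : majorant g ->
  (forall J, partial_sum g J <= B) -> 0 <= M ->
  (forall k, cabs (f k) <= M * g k) -> cabs (sum f) <= M * B.
Proof.
move=> mg gB M0 fM; apply/ler_addgt0Pr => e e0.
have /(@sum_cvg _ _ mg) : dominated g f by exists M.
move=> /cvg_cabs/(_ e e0)[J0 _ /(_ J0 (fsubset_refl _)) /= h].
rewrite cabsB in h.
have -> : sum f = partial_sum f J0 + (sum f - partial_sum f J0).
  by rewrite addrC subrK.
apply: le_trans (cabsD _ _) (lerD _ (ltW h)).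
apply: le_trans (_ : M * partial_sum g J0 <= _); last by rewrite ler_wpM2l.
rewrite !partial_sumE; apply: le_trans (cabs_sum _ _ _) _.
by rewrite mulr_sumr; apply: ler_sum.
Qed.

End UnorderedSums.

(** * Lattices *)

Section Box.
Variable R : realType.
Local Notation C := (Cplx R).

(** Integers from [-N] to [N] are indexed by naturals from 0 to [2 * N], so that sums over boxes
    telescope as sums over intervals of [nat]. *)
Definition centered (N i : nat) : int := i%:Z - N%:Z.

Definition box_seq (N : nat) : seq (int * int) :=
  [seq (centered N i, centered N j) |
     i <- iota 0 (2 * N).+1, j <- iota 0 (2 * N).+1].

Definition box (N : nat) : {fset int * int} := [fset k in box_seq N]%fset.

Lemma centered_inj N : injective (centered N).
Proof. by move=> i j; rewrite /centered; lia. Qed.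

Lemma mem_box N (k : int * int) :
  (k \in box N) = (`|k.1| <= N)%N && (`|k.2| <= N)%N.
Proof.
rewrite in_fset; apply/allpairsP/andP => [[[i j] []]|[k1 k2]].
  by rewrite !mem_iota /centered /= => ? ? -> /=; lia.
exists (`|(k.1 + N%:Z)%R|%N, `|(k.2 + N%:Z)%R|%N); rewrite !mem_iota /centered.
by case: k k1 k2 => [a b] /= ka kb; split; [lia|lia|congr pair; lia].
Qed.

Lemma box_sum (V : zmodType) (f : int * int -> V) N :
  partial_sum f (box N) = \sum_(0 <= i < (2 * N).+1)
    \sum_(0 <= j < (2 * N).+1) f (centered N i, centered N j).
Proof.
have us : uniq (box_seq N).
  apply: allpairs_uniq; rewrite ?iota_uniq // => -[i j] [i' j'] _ _ /= [e1 e2].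
  by rewrite (centered_inj e1) (centered_inj e2).
rewrite partial_sumE (perm_big (box_seq N)) /=; last first.
  by apply: uniq_perm; rewrite ?fset_uniq // => k; rewrite in_fset.
by rewrite big_allpairs_dep /= /index_iota subn0.
Qed.

Lemma box_absorbs (J : {fset int * int}) :
  exists N0, forall N, (N0 <= N)%N -> (J `<=` box N)%fset.
Proof.
exists (\sum_(k <- J) (`|k.1| + `|k.2|))%N => N JN; apply/fsubsetP => k kJ.
rewrite mem_box; move: JN; rewrite (big_rem k) //= => /(leq_trans (leq_addr _ _)).
by move=> kN; rewrite !(leq_trans _ kN) ?leq_addr ?leq_addl.
Qed.

(** An unordered sum can therefore be computed along boxes, where a shift by a period changes only
    the boundary. *)
Lemma box_totally : box N @[N --> \oo] --> totally.
Proof.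
move=> P [J _ JP]; have [N0 N0P] := box_absorbs J.
by exists N0 => // N /= /N0P; apply: JP.
Qed.

(* Telescoping and of order [n ^ (-3/2)], so that the product weight is summable
   and dominates the cubes of the inverses of the lattice points. *)
Definition weight1 (n : nat) : R :=
  (Num.sqrt n.+1%:R)^-1 - (Num.sqrt n.+2%:R)^-1.

Definition weight (k : int * int) : R := weight1 `|k.1|%N * weight1 `|k.2|%N.

(** Since [b ^+ 2 - a ^+ 2 = 1], the difference of the inverses is [1 / (a * b * (a + b))], and all
    three factors are controlled by [Num.sqrt M%:R]. *)
Lemma weight1_ge n M : (n.+2 <= M)%N ->
  (2 * Num.sqrt M%:R ^+ 3)^-1 <= weight1 n.
Proof.
move=> nM; rewrite /weight1.
set a := Num.sqrt n.+1%:R; set b := Num.sqrt n.+2%:R; set c := Num.sqrt M%:R.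
have a0 : 0 < a by rewrite sqrtr_gt0.
have ab : a <= b by rewrite ler_sqrt // ler_nat.
have b0 : 0 < b by apply: lt_le_trans ab.
have bc : b <= c by rewrite ler_sqrt // ler_nat.
have h : (b - a) * (b + a) = 1.
  rewrite -subr_sqr !sqr_sqrtr ?ler0n // -(natr1 n.+1); lra.
have -> : a^-1 - b^-1 = (a * b * (a + b))^-1.
  have -> : a^-1 - b^-1 = (b - a) / (a * b).
    by field; rewrite !lt0r_neq0.
  have s0 : b + a != 0 by rewrite lt0r_neq0 // addr_gt0.
  apply: (mulIf s0); rewrite mulrAC h; field.
  by rewrite !lt0r_neq0 // ?addr_gt0.
have a_c := le_trans ab bc; have c0 := lt_le_trans b0 bc.
rewrite lef_pV2 ?posrE ?mulr_gt0 ?exprn_gt0 ?addr_gt0 //.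
have -> : 2 * c ^+ 3 = c * c * (c + c) by ring.
by rewrite !ler_pM ?mulr_ge0 ?addr_ge0 ?(ltW a0) ?(ltW b0) // lerD.
Qed.

Lemma weight1_gt0 n : 0 < weight1 n.
Proof.
apply: lt_le_trans (weight1_ge (leqnn _)).
by rewrite invr_gt0 mulr_gt0 ?exprn_gt0 ?sqrtr_gt0.
Qed.

Lemma weight_gt0 k : 0 < weight k.
Proof. by rewrite mulr_gt0 ?weight1_gt0. Qed.

(** The exponent [3/2] in each variable is chosen so that the product reaches the cube of [M]. *)
Lemma weight_ge (k : int * int) M : (`|k.1| + 2 <= M)%N -> (`|k.2| + 2 <= M)%N ->
  (4 * M%:R ^+ 3)^-1 <= weight k.
Proof.
move=> k1 k2.
have -> : (4 * M%:R ^+ 3)^-1 =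
    (2 * Num.sqrt M%:R ^+ 3)^-1 * (2 * Num.sqrt M%:R ^+ 3)^-1 :> R.
  rewrite -invfM -{1}(sqr_sqrtr (ler0n R M)); congr (_^-1); ring.
have s0 : 0 <= (2 * Num.sqrt M%:R ^+ 3)^-1 :> R.
  by rewrite invr_ge0 mulr_ge0 ?exprn_ge0 ?sqrtr_ge0.
by apply: ler_pM => //; apply: weight1_ge; lia.
Qed.

Lemma weight1_sum N : \sum_(0 <= i < (2 * N).+1) weight1 `|centered N i|%N <= 2.
Proof.
have half n : \sum_(0 <= i < n) weight1 i <= 1.
  have -> : \sum_(0 <= i < n) weight1 i = 1 - (Num.sqrt n.+1%:R)^-1.
    elim: n => [|n IHn]; first by rewrite big_geq // sqrtr1 invr1 subrr.
    by rewrite big_nat_recr //= IHn /weight1 addrA subrK.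
  by rewrite gerDl oppr_le0 invr_ge0 sqrtr_ge0.
rewrite (big_cat_nat (n := N)) //=; last by lia.
have -> : 2 = 1 + 1 :> R by [].
apply: lerD.
  (* Read backwards, the left half runs over the absolute values 1 to [N]; adding the term of 0
     bounds it by a full telescoping sum. *)
  rewrite big_nat_rev /= add0n; apply: le_trans (half N.+1).
  rewrite [leRHS]big_nat_recl //= ler_wpDl ?(ltW (weight1_gt0 _)) //.
  rewrite !big_nat; apply: ler_sum => i iN.
  by rewrite (_ : `|_|%N = i.+1) // /centered; lia.
apply: le_trans (half N.+1); rewrite -{1}(add0n N) big_addn.
rewrite (_ : (2 * N).+1 - N = N.+1)%N; last by lia.
rewrite !big_nat; apply: ler_sum => i iN.
by rewrite (_ : `|_|%N = i) // /centered; lia.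
Qed.

Lemma weight_majorant : majorant weight.
Proof.
split=> [k|]; first exact: ltW (weight_gt0 k).
exists 4 => J; have [N /(_ N (leqnn N)) JN] := box_absorbs J.
apply: le_trans (partial_sum_le (fun k => ltW (weight_gt0 k)) JN) _.
rewrite box_sum.
set S := \sum_(0 <= i < (2 * N).+1) weight1 `|centered N i|%N.
have -> : \sum_(0 <= i < (2 * N).+1) \sum_(0 <= j < (2 * N).+1)
    weight (centered N i, centered N j) = S * S.
  by rewrite mulr_suml; apply: eq_bigr => i _; rewrite mulr_sumr.
rewrite (_ : 4 = 2 * 2); last by ring.
by rewrite ler_pM ?weight1_sum // sumr_ge0 // => i _; apply/ltW/weight1_gt0.
Qed.

End Box.

(** * Discreteness of the lattice and summability of inverse cubes *)

Section Lattice.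
Variable R : realType.
Local Notation C := (Cplx R).
Variable w : C.
Hypothesis wnr : w \isn't Num.real.
Local Notation pt := (lattice_pt w).

Lemma lattice_ptD (k l : int * int) : pt (k.1 + l.1, k.2 + l.2) = pt k + pt l.
Proof. by rewrite /lattice_pt /= !intrD mulrDl addrACA. Qed.

Lemma lattice_ptB (k l : int * int) : pt (k.1 - l.1, k.2 - l.2) = pt k - pt l.
Proof. by rewrite /lattice_pt /= !intrB mulrBl opprD addrACA. Qed.

Lemma lattice_ptN (l : int * int) : pt (- l.1, - l.2) = - pt l.
Proof. by rewrite /lattice_pt !intrN mulNr opprD. Qed.

Lemma cabs_int (m : int) : cabs (m%:~R : C) = `|m|%N%:R.
Proof. by rewrite -(rmorph_int (real_complex R)) cabs_real -intr_norm -abszE pmulrn. Qed.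

(** The imaginary part of [pt k] bounds [k.2], and then [pt k - k.2 * w] bounds [k.1]. *)
Lemma lattice_lb : exists2 D : R, 0 < D &
  forall k, `|k.1|%N%:R <= D * cabs (pt k) /\ `|k.2|%N%:R <= D * cabs (pt k).
Proof.
have wI := nonreal_Im wnr; pose e := `|complex.Im w|.
have e0 : 0 < e by rewrite normr_gt0.
pose D := 1 + e^-1 + cabs w / e.
have c0 := cabs_ge0 w.
have we0 : 0 <= cabs w / e by rewrite divr_ge0 // ltW.
have ei0 : 0 < e^-1 by rewrite invr_gt0.
exists D; first by rewrite /D; lra.
move=> [m n] /=; set z := pt _.
have zI : complex.Im z = n%:~R * complex.Im w.
  rewrite /z /lattice_pt /= -(rmorph_int (real_complex R) m).
  rewrite -(rmorph_int (real_complex R) n) cIm_add add0r.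
  by case: (w) => a b /=; rewrite mul0r addr0.
have z0 := cabs_ge0 z.
have hn : `|n|%N%:R <= e^-1 * cabs z.
  rewrite -(ler_pM2r e0) mulrAC mulVf ?lt0r_neq0 // mul1r.
  by apply: le_trans (cabs_Im z); rewrite zI normrM -intr_norm -abszE pmulrn.
split.
  have -> : `|m|%N%:R = cabs (z - n%:~R * w).
    by rewrite /z /lattice_pt /= addrK cabs_int.
  apply: le_trans (cabsD _ _) _; rewrite cabsN cabsM cabs_int.
  have := ler_wpM2r c0 hn.
  have -> : D * cabs z = cabs z + e^-1 * cabs z + e^-1 * cabs z * cabs w.
    by rewrite /D; field; rewrite lt0r_neq0.
  have : 0 <= e^-1 * cabs z by rewrite mulr_ge0 // ltW.
  lra.
apply: le_trans hn _; rewrite ler_wpM2r // /D; lra.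
Qed.

Lemma lattice_inj : injective pt.
Proof.
move=> k l /eqP; rewrite -subr_eq0 -lattice_ptB => /eqP kl.
have [D _ /(_ (k.1 - l.1, k.2 - l.2))] := lattice_lb.
rewrite kl cabs0 mulr0 /= !lern0 => -[h1 h2].
by case: k l {kl} h1 h2 => [a b] [c d] /= h1 h2; congr pair; lia.
Qed.

(** Distinct lattice points are at least [D^-1] apart, so at most one of those different from [q] is
    closer to [q] than half of this; if there is one, its distance is the required [d]. *)
Lemma lattice_discrete q : exists2 d : R, 0 < d &
  forall k, pt k != q -> d <= cabs (pt k - q).
Proof.
have [D D0 Dk] := lattice_lb.
have sep k l : k != l -> D^-1 <= cabs (pt k - pt l).
  move=> kl; rewrite -lattice_ptB; set u := (_, _).
  have : (1 <= `|u.1|)%N || (1 <= `|u.2|)%N.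
    rewrite /u /=; apply: contraNT kl; rewrite negb_or -!ltnNge !ltnS !leqn0 !absz_eq0.
    by rewrite !subr_eq0 -pair_eqE.
  rewrite -(ler_pM2l D0) mulfV ?lt0r_neq0 //.
  by have [h1 h2] := Dk u; case/orP => h; [apply: le_trans h1|apply: le_trans h2];
    rewrite ler1n.
have Di : 0 < D^-1 by rewrite invr_gt0.
have [[k [kq kd]]|hn] := pselect (exists k, pt k != q /\ cabs (pt k - q) < D^-1 / 2).
  exists (cabs (pt k - q)); first by rewrite cabs_gt0 subr_eq0.
  move=> l lq; have [->//|lk] := eqVneq l k.
  have := sep l k lk; have := cabsD (pt l - q) (q - pt k).
  by rewrite addrA subrK [cabs (q - _)]cabsB => h1 h2; lra.
exists (D^-1 / 2); first by rewrite divr_gt0.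
by move=> k kq; rewrite leNgt; apply/negP => h; apply: hn; exists k.
Qed.

Lemma lattice_cube q : exists2 B : R, 0 < B &
  forall k, pt k != q -> (cabs (pt k - q) ^+ 3)^-1 <= B * weight R k.
Proof.
have [D D0 Dk] := lattice_lb.
have [d d0 dk] := lattice_discrete q.
(* For nonzero [k], the integer [M] below is at most 3 times the larger coordinate, which is at most
   [D * cabs (pt k)]; the last factor compares [cabs (pt k)] with [cabs (pt k - q)], using that the
   latter is at least [d]. *)
pose E := 3 * D * (1 + cabs q / d).
have q0 := cabs_ge0 q.
have E0 : 0 < E by rewrite !mulr_gt0 // ltr_wpDr // divr_ge0 // ltW.
(* The factor 3 fails for the index [(0, 0)], which gets its own constant. *)
pose W := (d ^+ 3)^-1 / weight R (0, 0).
have W0 : 0 < W by rewrite divr_gt0 ?weight_gt0 // invr_gt0 exprn_gt0.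
exists (4 * E ^+ 3 + W); first by rewrite addr_gt0 // mulr_gt0 // exprn_gt0.
move=> k kq; have dkq := dk k kq; set m := cabs (pt k - q) in dkq *.
have m0 : 0 < m by apply: lt_le_trans dkq.
have wk0 := weight_gt0 R k.
have [->|k0] := eqVneq k (0, 0).
  apply: le_trans (_ : W * weight R (0, 0) <= _).
    rewrite /W divfK ?lt0r_neq0 ?weight_gt0 // lef_pV2 ?posrE ?exprn_gt0 //.
    by rewrite lerXn2r ?nnegrE ?(ltW d0) ?(ltW m0).
  by rewrite ler_wpM2r ?(ltW (weight_gt0 _ _)) // lerDr mulr_ge0 ?exprn_ge0 // ltW.
pose M := (maxn `|k.1| `|k.2| + 2)%N.
have M3 : (M <= 3 * maxn `|k.1| `|k.2|)%N.
  suff : (0 < maxn `|k.1| `|k.2|)%N by rewrite /M; move: (maxn _ _); clear; lia.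
  rewrite lt0n; apply: contraNneq k0 => h.
  by case: k h {kq dkq m m0 wk0 M} => a b /= h; apply/eqP; congr pair; lia.
have MD : M%:R <= E * m.
  apply: le_trans (_ : 3 * (D * cabs (pt k)) <= _).
    apply: le_trans (_ : (3 * maxn `|k.1| `|k.2|)%N%:R <= _); first by rewrite ler_nat.
    rewrite natrM ler_wpM2l //; have [h1 h2] := Dk k.
    by case: (leqP `|k.1| `|k.2|).
  have : cabs (pt k) <= (1 + cabs q / d) * m.
    have := cabsD (pt k - q) q; rewrite subrK -/m => h.
    apply: le_trans h _; rewrite mulrDl mul1r lerD2l -mulrA ler_peMr //.
    by rewrite mulrC ler_pdivlMr // mul1r.
  by rewrite /E -!mulrA !ler_pM2l.
have M0 : 0 < M%:R :> R by rewrite ltr0n /M addn2.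
have hw := @weight_ge R k M; apply: le_trans (_ : 4 * E ^+ 3 * weight R k <= _); last first.
  by rewrite ler_wpM2r ?(ltW wk0) // lerDl ltW.
have {}hw : (4 * M%:R ^+ 3)^-1 <= weight R k.
  by apply: hw; rewrite /M leq_add2r ?leq_maxl ?leq_maxr.
have E4 : 0 <= 4 * E ^+ 3 by rewrite mulr_ge0 ?exprn_ge0 ?(ltW E0).
apply: le_trans (ler_wpM2l E4 hw).
have -> : 4 * E ^+ 3 * (4 * M%:R ^+ 3)^-1 = E ^+ 3 / M%:R ^+ 3.
  by field; rewrite lt0r_neq0.
rewrite ler_pdivlMr ?exprn_gt0 // mulrC ler_pdivrMr ?exprn_gt0 // -exprMn.
apply: lerXn2r MD; rewrite nnegrE; [exact: ltW|exact: (mulr_ge0 (ltW E0) (ltW m0))].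
Qed.

End Lattice.

(** * The Weierstrass function *)

Section SumGerms.
Variables (R : realType) (I : choiceType).
Local Notation C := (Cplx R).

(** Weierstrass's theorem on series of analytic functions: the remainders of the sum are the sums of
    the remainders, since [r] and [K] do not depend on the index. *)
Lemma sum_remainders (F : I -> nat -> C -> C) (g : I -> R) (r M K : R) q :
  majorant g -> 0 < r -> 0 < K -> 0 <= M ->
  (forall k, remainders (F k) r (M * g k) K) ->
  analytic (fun z => sum (fun k => F k 0%N (z - q))) q.
Proof.
move=> mg r0 K0 M0 FP; have [g0 [B gB]] := mg.
have dom n u : cabs u < r -> dominated g (fun k => F k n u).
  move=> ur; exists (M * K ^+ n) => k; rewrite mulrAC.
  by have [] := FP k n u ur.
exists (fun n => sum (fun k => F k n 0)), (fun n u => sum (fun k => F k n u)).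
exists r, (M * B), K; split=> //.
  move=> n u ur; split.
    rewrite -(sum_lin _ mg (dom n 0 _) (dom n.+1 u ur)) ?cabs0 //.
    by congr sum; apply/funext => k; have [<-] := FP k n u ur.
  rewrite mulrAC; apply: (sum_le mg gB); first by rewrite mulr_ge0 ?exprn_ge0 ?(ltW K0).
  by move=> k; rewrite mulrAC; have [] := FP k n u ur.
by move=> u ur; congr sum; apply/funext => k; rewrite addrC addKr.
Qed.

Lemma sum_pointed (k0 : I) (c : C) : sum (fun k => if k == k0 then c else 0) = c.
Proof.
apply: sum_unique; apply/cvg_cabs => e e0; exists [fset k0]%fset => // J k0J.
have k0J' : k0 \in J by apply: (fsubsetP k0J); rewrite inE.
suff : partial_sum (fun k => if k == k0 then c else 0) J = c.
  by rewrite /partial_sum => ->; rewrite subrr cabs0.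
rewrite partial_sumE (big_fsetD1 k0) //= eqxx big_seq big1 => [|k].
  by rewrite addr0.
by rewrite !inE => /andP[/negbTE->].
Qed.

Lemma dominated_pointed (g : I -> R) (k0 : I) (c : C) : majorant g -> 0 < g k0 ->
  dominated g (fun k => if k == k0 then c else 0).
Proof.
move=> [g0 _] gk; exists (cabs c / g k0) => k; case: eqVneq => [->|_].
  by rewrite divfK ?lt0r_neq0.
by rewrite cabs0 mulr_ge0 ?divr_ge0 ?cabs_ge0 ?(ltW gk).
Qed.

End SumGerms.

Section Weierstrass.
Variable R : realType.
Local Notation C := (Cplx R).
Variable w : C.
Hypothesis wnr : w \isn't Num.real.
Local Notation pt := (lattice_pt w).
Local Notation G := (weight R).

(* The [n]-th Taylor remainder at [0] of [u |-> (u - m) ^- 2]. *)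
Definition pole_rem (m u : C) n : C :=
  m ^- n * (n.+1%:R - n%:R * (u / m)) / (u - m) ^+ 2.

Lemma pole_remS (m u : C) n : m != 0 -> u != m ->
  pole_rem m u n = pole_rem m 0 n + u * pole_rem m u n.+1.
Proof.
move=> m0 um; have um0 : u - m != 0 by rewrite subr_eq0.
have m00 : 0 - m != 0 by rewrite sub0r oppr_eq0.
rewrite /pole_rem [m ^+ n.+1]exprSr -!natr1; field.
by rewrite um0 m0 ?m00 expf_neq0.
Qed.

(** As [cabs u < cabs m / 2], the denominator is at least [(cabs m / 2) ^+ 2]. Three powers of
    [1 / cabs m] are kept for summability and the others are traded for powers of [1 / d]; the
    numerator is at most [2 * n + 3 <= 3 ^ (n + 1)]. At order 0 there would be only two powers,
    hence [n.+1]. *)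
Lemma pole_rem_le (d : R) (m u : C) n : 0 < d -> d <= cabs m -> cabs u < d / 2 ->
  cabs (pole_rem m u n.+1) <= 4 * d * (cabs m ^+ 3)^-1 * (3 / d) ^+ n.+1.
Proof.
move=> d0 dm ud; set a := cabs m in dm *.
have a0 : 0 < a by apply: lt_le_trans dm.
have u0 := cabs_ge0 u.
have v0 : a / 2 <= cabs (u - m).
  by have := cabs_lb (- m) u; rewrite cabsN [- m + u]addrC -/a; lra.
rewrite /pole_rem !cabsM !cabsV !cabsX -/a.
have h1 : cabs (n.+2%:R - n.+1%:R * (u / m)) <= 3 ^+ n.+1.
  apply: le_trans (cabsD _ _) _; rewrite cabsN !cabsM !cabs_nat cabsV -/a.
  have um : cabs u / a <= 1 by rewrite ler_pdivrMr // mul1r; lra.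
  apply: le_trans (_ : n.+2%:R + n.+1%:R * 1 <= _).
    by rewrite lerD2l ler_wpM2l.
  rewrite mulr1 -natrD -natrX ler_nat; clear; elim: n => [//|n IHn].
  by rewrite expnS; lia.
have h2 : (cabs (u - m) ^+ 2)^-1 <= 4 / a ^+ 2.
  have -> : 4 / a ^+ 2 = ((a / 2) ^+ 2)^-1 by field; rewrite lt0r_neq0.
  have a2 : 0 < a / 2 by rewrite divr_gt0.
  rewrite lef_pV2 ?posrE ?exprn_gt0 ?(lt_le_trans a2 v0) //.
  by apply: lerXn2r v0; rewrite nnegrE ?cabs_ge0 ?ltW.
have an : (a ^+ n)^-1 <= (d ^+ n)^-1.
  rewrite lef_pV2 ?posrE ?exprn_gt0 //; apply: lerXn2r dm; rewrite nnegrE ltW //.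
have an0 : 0 <= (a ^+ n.+1)^-1 by rewrite invr_ge0 exprn_ge0 // ltW.
apply: le_trans (_ : (a ^+ n.+1)^-1 * 3 ^+ n.+1 * (4 / a ^+ 2) <= _).
  apply: ler_pM => //; rewrite ?mulr_ge0 ?cabs_ge0 //.
    by rewrite invr_ge0 exprn_ge0 // cabs_ge0.
  by rewrite ler_wpM2l.
have -> : (a ^+ n.+1)^-1 * 3 ^+ n.+1 * (4 / a ^+ 2) =
    4 * 3 ^+ n.+1 * (a ^+ 3)^-1 * (a ^+ n)^-1.
  rewrite exprSr; field; by rewrite expf_neq0 ?lt0r_neq0.
have -> : 4 * d * (a ^+ 3)^-1 * (3 / d) ^+ n.+1 =
    4 * 3 ^+ n.+1 * (a ^+ 3)^-1 * (d ^+ n)^-1.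
  rewrite expr_div_n [d ^+ n.+1]exprSr; field.
  by rewrite expf_neq0 ?lt0r_neq0.
by rewrite ler_wpM2l // !mulr_ge0 ?invr_ge0 ?exprn_ge0 ?(ltW a0).
Qed.

(* Since [0 ^- 2 = 0], the term of index [(0, 0)] is [z ^- 2]. *)
Definition wp_term k z : C := (z - pt k) ^- 2 - (pt k) ^- 2.

(** With [m = q - l], the difference of the inverse squares is [- q * (m - l) / (m ^+ 2 * l ^+ 2)],
    which is cubic in the inverse distance. In [A], the summand 1 serves [l = 0] and [(1 + c) * c]
    the other points. *)
Lemma wp_term_le q : exists2 A : R, 0 <= A &
  forall k, pt k != q -> cabs (wp_term k q) <= A * (cabs (pt k - q) ^+ 3)^-1.
Proof.
have [d d0 dk] := lattice_discrete wnr 0.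
pose c := 1 + cabs q / d; have q0 := cabs_ge0 q.
have c0 : 0 < c by rewrite ltr_wpDr // divr_ge0 // ltW.
exists (cabs q * (1 + (1 + c) * c)).
  by rewrite mulr_ge0 // addr_ge0 // mulr_ge0 ?(ltW c0) // addr_ge0 // ltW.
move=> k kq; rewrite /wp_term; set l := pt k in kq *.
have -> : cabs (l - q) = cabs (q - l) by rewrite cabsB.
set m := q - l; have m0 : m != 0 by rewrite subr_eq0 eq_sym.
have cm0 : 0 < cabs m by rewrite cabs_gt0.
have cc0 : 0 <= (1 + c) * c by rewrite mulr_ge0 ?(ltW c0) // addr_ge0 // ltW.
have [l0|l0] := eqVneq l 0.
  rewrite /m l0 subr0 expr0n invr0 subr0 cabsV cabsX.
  have qq0 : 0 < cabs q by move: cm0; rewrite /m l0 subr0.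
  have -> : (cabs q ^+ 2)^-1 = cabs q * (cabs q ^+ 3)^-1.
    by field; rewrite lt0r_neq0.
  by rewrite ler_wpM2r ?invr_ge0 ?exprn_ge0 // ler_peMr // lerDl.
have cl0 : 0 < cabs l by rewrite cabs_gt0.
have mc : cabs m <= c * cabs l.
  apply: le_trans (cabsD _ _) _; rewrite cabsN /c mulrDl mul1r addrC lerD2l.
  have := dk k; rewrite subr0 -/l => /(_ l0) dl.
  by rewrite -mulrA ler_peMr // mulrC ler_pdivlMr // mul1r.
have -> : m ^- 2 - l ^- 2 = - (q * (m - l)) / (m ^+ 2 * l ^+ 2).
  have -> : q = m + l by rewrite /m subrK.
  by field; rewrite l0 m0.
rewrite cabsM cabsN cabsV (cabsM q) (cabsM (m ^+ 2)) !cabsX.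
have h : cabs (m - l) * cabs m <= (1 + c) * c * cabs l ^+ 2.
  have -> : (1 + c) * c * cabs l ^+ 2 = (cabs l + c * cabs l) * (c * cabs l) by ring.
  apply: ler_pM; rewrite ?cabs_ge0 //.
  by apply: le_trans (cabsD _ _) _; rewrite cabsN addrC lerD2l.
rewrite ler_pdivrMr ?mulr_gt0 ?exprn_gt0 //.
have -> : cabs q * (1 + (1 + c) * c) / cabs m ^+ 3 * (cabs m ^+ 2 * cabs l ^+ 2) =
  cabs q * ((1 + (1 + c) * c) * cabs l ^+ 2) / cabs m.
  by field; rewrite lt0r_neq0.
rewrite ler_pdivlMr // -mulrA ler_wpM2l //; apply: le_trans h _.
by rewrite ler_wpM2r ?exprn_ge0 ?cabs_ge0 // lerDr.
Qed.

(** Remainders at [q] of the terms without pole there; the normalizing constant only affects order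
    0. *)
Definition wp_rem q k n u : C :=
  if pt k == q then 0
  else pole_rem (pt k - q) u n - (if n == 0%N then pt k ^- 2 else 0).

Lemma wp_rem0 q k u : wp_rem q k 0 u = if pt k == q then 0 else wp_term k (q + u).
Proof.
rewrite /wp_rem /pole_rem /wp_term; case: ifP => // _.
by rewrite expr0 invr1 mul1r mul0r subr0 mul1r opprB addrA [u + q]addrC.
Qed.

Lemma wp_remainders q : exists r M K : R, [/\ 0 < r, 0 < K, 0 <= M &
  forall k, remainders (wp_rem q k) r (M * G k) K].
Proof.
have [d d0 dk] := lattice_discrete wnr q.
have [B B0 Bk] := lattice_cube wnr q.
have [A A0 Ak] := wp_term_le q.
(* Order 0 needs [A] for the value at the centre and [6 * d] for the first remainder times [d / 2];
   higher orders need [4 * d]. *)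
pose M := A + 10 * d; have M0 : 0 <= M by rewrite addr_ge0 // mulr_ge0 // ltW.
have d20 : 0 < d / 2 by rewrite divr_gt0.
exists (d / 2), (M * B), (3 / d); split; rewrite ?divr_gt0 ?mulr_ge0 ?(ltW B0) //.
move=> k n u ud; have g0 := weight_gt0 R k.
rewrite /wp_rem; case: ifP => [_|/negbT kq].
  split; first by rewrite mulr0 addr0.
  rewrite cabs0; apply: mulr_ge0; last by rewrite exprn_ge0 // divr_ge0 // ltW.
  by rewrite mulr_ge0 ?(ltW g0) // mulr_ge0 // ltW.
have dm := dk k kq; set m := pt k - q in dm *.
have m0 : m != 0 by rewrite subr_eq0.
have um : u != m by apply: contraTneq dm => <-; rewrite -ltNge; lra.
split; first by rewrite (pole_remS _ m0 um) /= subr0; ring.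
have aB : (cabs m ^+ 3)^-1 <= B * G k by apply: Bk.
have a30 : 0 <= (cabs m ^+ 3)^-1 by rewrite invr_ge0 exprn_ge0 ?cabs_ge0.
apply: le_trans (_ : M * (cabs m ^+ 3)^-1 * (3 / d) ^+ n <= _); last first.
  by rewrite ler_wpM2r ?exprn_ge0 ?divr_ge0 ?(ltW d0) // -mulrA ler_wpM2l.
case: n => [|n]; last first.
  rewrite subr0; apply: le_trans (pole_rem_le _ d0 dm ud) _.
  by rewrite !ler_wpM2r ?exprn_ge0 ?divr_ge0 ?(ltW d0) // /M; lra.
rewrite expr0 mulr1 (pole_remS _ m0 um) addrAC.
apply: le_trans (cabsD _ _) _; rewrite /M mulrDl; apply: lerD.
  have := Ak k kq; have := wp_rem0 q k 0; rewrite /wp_rem (negbTE kq) addr0.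
  by move=> /= ->.
rewrite cabsM; apply: le_trans (ler_pM (cabs_ge0 _) (cabs_ge0 _) (ltW ud) (pole_rem_le 0 d0 dm ud)) _.
set a3 := (cabs m ^+ 3)^-1 in a30 *.
have -> : d / 2 * (4 * d * a3 * (3 / d) ^+ 1) = 6 * d * a3.
  by rewrite expr1; field; rewrite lt0r_neq0.
by rewrite ler_wpM2r //; lra.
Qed.

End Weierstrass.

(** * Analyticity, poles and periods of the Weierstrass function *)

Section WeierstrassP.
Variable R : realType.
Local Notation C := (Cplx R).
Variable w : C.
Hypothesis wnr : w \isn't Num.real.
Local Notation pt := (lattice_pt w).
Local Notation G := (weight R).
Local Notation wp := (weierstrass_p w).

(** If [z] is a lattice point, the estimate omits exactly one index, whose finite default term is
    absorbed by enlarging the constant. *)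
Lemma wp_dominated z : dominated G (fun k => wp_term w k z).
Proof.
have [r [M [K [r0 K0 M0 rem]]]] := wp_remainders wnr z.
have TM k : pt k != z -> cabs (wp_term w k z) <= M * G k.
  move=> kz; have [|_] := rem k 0%N 0; first by rewrite cabs0.
  by rewrite wp_rem0 (negbTE kz) addr0 mulr1.
have [[k0 k0z]|nk] := pselect (exists k, pt k = z); last first.
  by exists M => k; apply: TM; apply/eqP => kz; apply: nk; exists k.
have [B hB] := dominated_pointed (wp_term w k0 z) (weight_majorant R) (weight_gt0 R k0).
exists (M + B) => k; rewrite mulrDl; have g0 := ltW (weight_gt0 R k).
have [kz|kz] := eqVneq (pt k) z.
  have -> : k = k0 by apply: (lattice_inj wnr); rewrite kz k0z.
  have := hB k0; rewrite eqxx => h; apply: le_trans h _.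
  by rewrite lerDr mulr_ge0 // ltW // weight_gt0.
apply: le_trans (TM k kz) _; rewrite lerDl.
by apply: le_trans (hB k); apply: cabs_ge0.
Qed.

Lemma wpE z : wp z = sum (fun k => wp_term w k z).
Proof.
have T0 : wp_term w (0, 0) z = z ^- 2.
  by rewrite /wp_term /lattice_pt /= mul0r add0r expr0n invr0 !subr0.
rewrite /weierstrass_p; set f := (X in sum X).
have fT k : wp_term w k z = f k + 1 * (if k == (0, 0) then z ^- 2 else 0).
  by rewrite mul1r /f; case: eqP => [->|_]; rewrite ?T0 ?add0r ?addr0.
have df : dominated G f.
  apply: dominated_le (wp_dominated z) => k; rewrite /f; case: eqP => // _.
  by rewrite cabs0 cabs_ge0.
under [in RHS]eq_fun do rewrite fT.
rewrite (sum_lin _ (weight_majorant R) df) ?sum_pointed ?mul1r; first by rewrite addrC.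
by apply: dominated_pointed; [apply: weight_majorant|apply: weight_gt0].
Qed.

Lemma wp_rem_analytic q :
  analytic (fun z => sum (fun k => if pt k == q then 0 else wp_term w k z)) q.
Proof.
have [r [M [K [r0 K0 M0 rem]]]] := wp_remainders wnr q.
have := @sum_remainders R _ (wp_rem w q) _ r M K q (weight_majorant R) r0 K0 M0 rem.
apply: (analytic_ext ltr01) => u _; congr sum; apply/funext => k.
by rewrite wp_rem0 [q + u]addrC addrK addrC.
Qed.

Lemma wp_analytic q : (forall k, pt k != q) -> analytic wp q.
Proof.
move=> kq; apply: (analytic_ext ltr01) (wp_rem_analytic q) => u _.
rewrite wpE; congr sum; apply/funext => k.
by rewrite (negbTE (kq k)).
Qed.

Lemma wp_polar k0 : exists2 h, analytic h (pt k0) &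
  forall z, wp z = h z + wp_term w k0 z.
Proof.
eexists; first exact: (wp_rem_analytic (pt k0)).
move=> z /=; rewrite wpE -[X in _ = _ + X]mul1r -[X in 1 * X](sum_pointed k0).
rewrite -(sum_lin _ (weight_majorant R)).
- refine (congr1 (fun f : int * int -> C => sum f : C) _); apply/funext => k.
  rewrite (inj_eq (lattice_inj wnr)) mul1r.
  by case: eqP => [->|_]; rewrite ?add0r ?addr0.
- apply: dominated_le (wp_dominated z) => k; case: ifP => // _.
  by rewrite cabs0 cabs_ge0.
- by apply: dominated_pointed; [apply: weight_majorant|apply: weight_gt0].
Qed.

Lemma wp_pole k0 : exists g, [/\ analytic g (pt k0), g (pt k0) = 1 &
  punctured (pt k0) (fun z => wp z * (z - pt k0) ^+ 2 = g z)].
Proof.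
have [h ha hE] := wp_polar k0; set q := pt k0 in ha *.
exists (fun z => 1 + (z - q) ^+ 2 * (h z + - q ^- 2)); split.
- apply: analytic_add; first exact: analytic_cst.
  apply: analytic_mul; first by apply: analytic_exp; apply: analytic_sub.
  by apply: analytic_add => //; apply: analytic_cst.
- by rewrite subrr expr0n mul0r addr0.
exists 1 => // u u0 _; rewrite hE /wp_term -/q [q + u]addrC addrK.
rewrite addrCA mulrDl mulVf ?expf_neq0 //; ring.
Qed.

Lemma wp_double_pole q : double_pole wp q.
Proof.
have [[k0 <-]|nq] := pselect (exists k, pt k = q).
  by have [g [ga _ gE]] := wp_pole k0; exists g.
exists (fun z => wp z * (z - q) ^+ 2); last by exists 1.
apply: analytic_mul; last by apply: analytic_exp; apply: analytic_sub.
by apply: wp_analytic => k; apply/eqP => kq; apply: nq; exists k.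
Qed.

(** A bound on [wp] would force [wp z * (z - pt k0) ^+ 2] to tend to 0, but it agrees off the pole
    with a [g] whose value there is 1. *)
Lemma wp_unbounded k0 (B r : R) : 0 < r ->
  (forall u, cabs u < r -> cabs (wp (pt k0 + u)) <= B) -> False.
Proof.
move=> r0 hB; have [g [[a ga] g1 gE]] := wp_pole k0; set q := pt k0 in hB ga g1 gE.
have B0 : 0 <= B by apply: le_trans (hB 0 _); rewrite ?cabs_ge0 ?cabs0.
have [s [D [s0 D0 gD]]] := germ_lipschitz ga.
have h1 : punctured q (fun z => cabs (z - q) < r /\
   [/\ cabs (z - q) < 1, cabs (g z - 1) <= D * cabs (z - q) &
       cabs (z - q) * (B + D) < 1]).
  pose e := Num.min (Num.min r 1) (Num.min s (B + D)^-1).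
  have BD : 0 < B + D by rewrite ltr_wpDl.
  exists e; first by rewrite !lt_min r0 s0 ltr01 invr_gt0.
  move=> u u0; rewrite !lt_min [q + u]addrC addrK.
  move=> /andP[/andP[ur u1] /andP[us uB]]; split=> //; split=> //.
    by rewrite -g1 addrC; apply: gD.
  by rewrite -ltr_pdivlMr // mul1r.
have [z [gz [zr [z1 zD zB]]]] := punctured_ex (puncturedI gE h1).
have := hB _ zr; rewrite [q + _]addrC subrK => zB'.
have h2 : cabs (g z) <= B * cabs (z - q).
  rewrite -gz cabsM cabsX; apply: ler_pM; rewrite ?cabs_ge0 ?exprn_ge0 ?cabs_ge0 //.
  by rewrite expr2 ler_piMr ?cabs_ge0 // ltW.
have := cabs_lb (g z - 1) (- g z); rewrite addrAC subrr add0r !cabsN cabs1.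
have := cabsD (g z) (- (g z - 1)); rewrite opprB addrC subrK cabs1 cabsB.
lra.
Qed.

Lemma lattice_punctured q : punctured q (fun z => forall k, pt k != z).
Proof.
have [d d0 dk] := lattice_discrete wnr q.
exists d => // u u0 ud k; apply/eqP => ku.
have := dk k; rewrite ku [q + u]addrC addrK -subr_eq0 addrK => /(_ u0).
by rewrite leNgt ud.
Qed.

(** This estimates the boundary terms left when sums over boxes telescope: there are about [2 * N]
    of them on each side, each of order [N ^- 2]. *)
Lemma far_lattice (z : C) : exists2 D : R, 0 < D & exists N0, forall N k,
  (N0 <= N)%N -> (0 < N)%N -> (N <= `|k.1|)%N || (N <= `|k.2|)%N ->
  cabs ((z - pt k) ^- 2) <= D / N%:R ^+ 2.
Proof.
have [D D0 Dk] := lattice_lb wnr.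
exists (4 * D ^+ 2); first by rewrite mulr_gt0 // exprn_gt0.
pose N0 := Num.bound (2 * D * cabs z); exists N0 => N k N0N N1 Nk.
have Nr : 0 < N%:R :> R by rewrite ltr0n.
have hN : 2 * D * cabs z <= N%:R.
  apply: (@le_trans _ _ N0%:R); last by rewrite ler_nat.
  by apply/ltW/archi_boundP; rewrite !mulr_ge0 ?cabs_ge0 // ltW.
have h1 : N%:R <= D * cabs (pt k).
  by have [ha hb] := Dk k; case/orP: Nk => h; [apply: le_trans ha|apply: le_trans hb];
    rewrite ler_nat.
have h2 : N%:R / (2 * D) <= cabs (z - pt k).
  rewrite ler_pdivrMr ?mulr_gt0 //.
  have := ler_wpM2l (ltW D0) (cabs_lb (- pt k) z).
  by rewrite cabsN [- pt k + z]addrC; lra.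
have h0 : 0 < N%:R / (2 * D) by rewrite divr_gt0 ?mulr_gt0.
have -> : 4 * D ^+ 2 / N%:R ^+ 2 = ((N%:R / (2 * D)) ^+ 2)^-1.
  by field; rewrite !lt0r_neq0.
rewrite cabsV cabsX lef_pV2 ?posrE ?exprn_gt0 ?(lt_le_trans h0 h2) //.
by apply: lerXn2r h2; rewrite nnegrE ?cabs_ge0 // ltW.
Qed.

Lemma telescope_bound (a : nat -> nat -> C) (n : nat) (b : R) :
  (forall j, cabs (a 0%N j) <= b) -> (forall j, cabs (a n j) <= b) ->
  cabs (\sum_(0 <= j < n) \sum_(0 <= i < n) (a i j - a i.+1 j)) <= n%:R * (2 * b).
Proof.
move=> a0 an; apply: le_trans (cabs_sum _ _ _) _.
apply: (@le_trans _ _ (\sum_(0 <= j < n) 2 * b)).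
  apply: ler_sum => j _.
  have -> : \sum_(0 <= i < n) (a i j - a i.+1 j) = a 0%N j - a n j.
    rewrite -[RHS]opprB -(telescope_sumr (a^~ j) (leq0n n)) -sumrN.
    by apply: eq_bigr => i _; rewrite opprB.
  apply: le_trans (cabsD _ _) _; rewrite cabsN mulrDl mul1r.
  exact: lerD.
by rewrite sumr_const_nat subn0 [leRHS]mulr_natl.
Qed.

Lemma wp_box z : partial_sum (fun k => wp_term w k z) (box N) @[N --> \oo] --> wp z.
Proof.
rewrite wpE; apply: (cvg_comp box (partial_sum (fun k => wp_term w k z)) box_totally).
exact: sum_cvg (weight_majorant R) (wp_dominated z).
Qed.

Lemma wp_shift (d z : C) (b : nat -> R) :
  (forall e : R, 0 < e -> \forall N \near \oo, b N < e) ->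
  (\forall N \near \oo, cabs (partial_sum (fun k => wp_term w k (z + d)) (box N) -
        partial_sum (fun k => wp_term w k z) (box N)) <= b N) ->
  wp (z + d) = wp z.
Proof.
move=> b0 hb; apply/eqP; rewrite -subr_eq0 -cabs_eq0 eq_le cabs_ge0 andbT.
apply/ler_addgt0Pr => e e0; rewrite add0r.
have e20 : 0 < e / 2 by rewrite divr_gt0.
have hc : (partial_sum (fun k => wp_term w k (z + d)) (box N) -
    partial_sum (fun k => wp_term w k z) (box N)) @[N --> \oo] --> wp (z + d) - wp z.
  by apply: cvgB; apply: wp_box.
move/cvg_cabs: hc => /(_ _ e20) h.
move: h hb (b0 _ e20) => [N1 _ h1] [N2 _ h2] [N3 _ h3].
pose N := maxn N1 (maxn N2 N3).
have {}h1 := h1 N (leq_maxl _ _).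
have {}h2 := h2 N (leq_trans (leq_maxl _ _) (leq_maxr _ _)).
have {}h3 := h3 N (leq_trans (leq_maxr _ _) (leq_maxr _ _)).
rewrite /= in h1 h2 h3.
move: h1 h2; set D := (X in cabs X <= _); set L := wp _ - _ => h1 h2.
have h4 : cabs (D - L) < e / 2 by exact: h1.
have := cabsD (- (D - L)) D; rewrite cabsN opprB subrK; lra.
Qed.

Lemma wp_box_diff (d z : C) N :
  partial_sum (fun k => wp_term w k (z + d)) (box N) -
        partial_sum (fun k => wp_term w k z) (box N) =
  partial_sum (fun k => (z + d - pt k) ^- 2 - (z - pt k) ^- 2) (box N).
Proof.
rewrite !partial_sumE -sumrB; apply: eq_bigr => k _; rewrite /wp_term.
by rewrite opprB addrA subrK.
Qed.

Lemma box_bound_cvg0 (D : R) : 0 <= D -> forall e : R, 0 < e ->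
  \forall N \near \oo, (2 * N).+1%:R * (2 * (D / N%:R ^+ 2)) < e.
Proof.
(* The factor 6 is 2 times 3, with [2 * N + 1 <= 3 * N] for positive [N]. *)
move=> D0 e e0; pose N0 := Num.bound (6 * D / e).
exists N0.+1 => // N /= N0N.
have N1 : 1 <= N%:R :> R by rewrite ler1n; apply: leq_ltn_trans N0N.
have Nr : 0 < N%:R :> R by apply: lt_le_trans N1.
have : 6 * D / e < N%:R.
  apply: lt_le_trans (archi_boundP _) _; last by rewrite ler_nat ltnW.
  by rewrite divr_ge0 ?mulr_ge0 // ltW.
rewrite ltr_pdivrMr // => h.
have -> : (2 * N).+1%:R * (2 * (D / N%:R ^+ 2)) =
    (2 * N).+1%:R * (2 * D) / N%:R / N%:R :> R by field; rewrite lt0r_neq0.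
rewrite ltr_pdivrMr // [ltRHS]mulrC; apply: le_lt_trans h.
rewrite ler_pdivrMr // -natr1 natrM; nra.
Qed.

Lemma lattice_pt_pred1 (m n : int) : pt (m - 1, n) = pt (m, n) - 1.
Proof. by rewrite /lattice_pt intrB addrAC. Qed.

Lemma lattice_pt_pred2 (m n : int) : pt (m, n - 1) = pt (m, n) - w.
Proof. by rewrite /lattice_pt intrB mulrBl mul1r addrA. Qed.

(* This holds at the lattice points too: the telescoping of the partial sums over
   boxes does not depend on the value of [0 ^- 2]. *)
Lemma wp_lattice_periodic : lattice_periodic w wp.
Proof.
move=> z; have [D D0 [N0 hN0]] := far_lattice z.
have b0 := box_bound_cvg0 (ltW D0); split; apply: (wp_shift b0).
  exists N0.+1 => // N /= N0N; rewrite wp_box_diff box_sum exchange_big /=.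
  have N1 : (0 < N)%N by apply: leq_ltn_trans N0N.
  (* Adding a period lowers an index by one, so [a i.+1 j] is the unshifted term; the surviving
     columns have first coordinates [-N - 1] and [N]. *)
  pose a i j := (z - pt (centered N i - 1, centered N j)) ^- 2.
  have -> : \sum_(0 <= j < (2 * N).+1) \sum_(0 <= i < (2 * N).+1)
      ((z + 1 - pt (centered N i, centered N j)) ^- 2 -
       (z - pt (centered N i, centered N j)) ^- 2) =
      \sum_(0 <= j < (2 * N).+1) \sum_(0 <= i < (2 * N).+1) (a i j - a i.+1 j).
    apply: eq_bigr => j _; apply: eq_bigr => i _; congr (_ ^- 2 - _ ^- 2).
      by rewrite lattice_pt_pred1 opprB addrA.
    by rewrite (_ : centered N i.+1 - 1 = centered N i) // /centered; lia.
  apply: telescope_bound => j; apply: hN0; rewrite ?(ltnW N0N) //= /centered;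
    apply/orP; left; clear; lia.
exists N0.+1 => // N /= N0N; rewrite wp_box_diff box_sum /=.
have N1 : (0 < N)%N by apply: leq_ltn_trans N0N.
pose a i j := (z - pt (centered N j, centered N i - 1)) ^- 2.
have -> : \sum_(0 <= j < (2 * N).+1) \sum_(0 <= i < (2 * N).+1)
    ((z + w - pt (centered N j, centered N i)) ^- 2 -
     (z - pt (centered N j, centered N i)) ^- 2) =
    \sum_(0 <= j < (2 * N).+1) \sum_(0 <= i < (2 * N).+1) (a i j - a i.+1 j).
  apply: eq_bigr => j _; apply: eq_bigr => i _; congr (_ ^- 2 - _ ^- 2).
    by rewrite lattice_pt_pred2 opprB addrA.
  by rewrite (_ : centered N i.+1 - 1 = centered N i) // /centered; lia.
apply: telescope_bound => j; apply: hN0; rewrite ?(ltnW N0N) //= /centered;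
  apply/orP; right; clear; lia.
Qed.

End WeierstrassP.

(** * Automorphisms of a locally Nash structure on the plane *)

Section Automorphisms.
Variable R : realType.
Local Notation C := (Cplx R).
Implicit Types (f g h : C -> C) (a b p z u : C) (U : set C).

Lemma derivable_quotient f p : derivable f p 1 -> exists l : C, forall e : R, 0 < e ->
  exists2 r : R, 0 < r & forall u, u != 0 -> cabs u < r ->
    cabs (u^-1 * (f (p + u) - f p) - l) < e.
Proof.
move=> fp; exists (lim (u^-1 *: ((f \o shift p) (u *: 1) - f p) @[u --> 0^'])) => e e0.
have /cvg_cabs/(_ e e0) : u^-1 *: ((f \o shift p) (u *: 1) - f p) @[u --> 0^'] -->
  lim (u^-1 *: ((f \o shift p) (u *: 1) - f p) @[u --> 0^']) by exact: fp.
rewrite /dnbhs /within /= => /nbhs_cabs[r r0 rP]; exists r => // u u0 ur.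
have := rP u ur; rewrite add0r => /(_ u0) /=.
by rewrite /GRing.scale /= mulr1 [u + p]addrC.
Qed.

Lemma derivable_comp f g p : derivable f p 1 -> derivable g (f p) 1 ->
  derivable (g \o f) p 1.
Proof.
move=> fp gp; have dfp := (derivable1_diffP f p).1 fp.
have dgp := (derivable1_diffP g (f p)).1 gp.
apply: (derivable1_diffP (g \o f) p).2.
exact: (@differentiable_comp _ _ _ _ f g p dfp dgp).
Qed.

Lemma derivable_cts f p : derivable f p 1 -> forall A, nbhs (f p) A ->
  exists2 r : R, 0 < r & forall u, cabs u < r -> A (f (p + u)).
Proof.
move=> /derivable1_diffP/differentiable_continuous fp A /fp.
by move=> /nbhs_cabs.
Qed.

Lemma derivable_affine (c d : C) p : derivable (fun z : C => c * z + d) p 1.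
Proof.
apply: derivableD; last exact: derivable_cst.
by apply: derivableM; [exact: derivable_cst|exact: derivable_id].
Qed.

Lemma derivable_affine_of f (c d : C) p : derivable f p 1 ->
  derivable (fun z : C => c * f z + d) p 1.
Proof.
move=> fp; apply: (@derivable_comp f (fun z : C => c * z + d) p fp).
exact: derivable_affine.
Qed.

(** Additivity makes [g z / z] equal to the difference quotient of [g] at 0 for the increment
    [z / n], for every [n]; letting [n] grow identifies it with the limit [l]. *)
Lemma additive_derivable g : {morph g : x y / x + y} ->
  derivable g 0 1 -> exists l, forall z, g z = l * z.
Proof.
move=> gD /derivable_quotient[l lP]; exists l => z.
have g0 : g 0 = 0 by apply: (@addrI _ (g 0)); rewrite -gD !addr0.
have gn n x : g (n%:R * x) = n%:R * g x.
  elim: n => [|n IHn]; first by rewrite !mul0r g0.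
  by rewrite -natr1 !mulrDl !mul1r gD IHn.
have [->|z0] := eqVneq z 0; first by rewrite g0 mulr0.
have cz0 : 0 < cabs z by rewrite cabs_gt0.
apply/eqP; rewrite -subr_eq0 -cabs_eq0 eq_le cabs_ge0 andbT.
apply/ler_addgt0Pr => e e0; rewrite add0r.
have [|r r0 rP] := lP (e / cabs z); first by rewrite divr_gt0.
pose n := (Num.bound (cabs z / r)).+1.
have n0 : n%:R != 0 :> C by rewrite pnatr_eq0.
have nr : 0 < n%:R :> R by rewrite ltr0n.
pose u := n%:R^-1 * z; have u0 : u != 0 by rewrite mulf_neq0 ?invr_eq0.
have zu : z = n%:R * u by rewrite /u mulrA mulfV // mul1r.
have cu : cabs u < r.
  rewrite /u cabsM cabsV cabs_nat mulrC ltr_pdivrMr // mulrC -ltr_pdivrMr //.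
  apply: lt_trans (archi_boundP _) _; last by rewrite ltr_nat.
  by rewrite divr_ge0 ?cabs_ge0 // ltW.
have := rP u u0 cu; rewrite add0r g0 subr0 ltr_pdivlMr // => /ltW.
rewrite zu gn -cabsM (_ : (u^-1 * g u - l) * (n%:R * u) = n%:R * g u - l * (n%:R * u)) //.
by field.
Qed.

(** The offset [b] is [alpha * c - d] when multiplication by [alpha] is read from the chart
    translated by [c] to the one translated by [d]. *)
Definition relation f a (alpha b : C) (P : {poly {poly C}}) u :=
  P.[(f (alpha * u + b + a))%:P].[f (u + a)] = 0.

Section Chart.
Variables (f : C -> C) (a : C) (U : set C).
Hypothesis fU : chart_at_origin f a U.
Let phi u := f (u + a).

Lemma chart_inverse : exists psi, [/\ open U, open (phi @` U),
  forall u, U u -> derivable phi u 1, forall y, (phi @` U) y -> derivable psi y 1 &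
  forall u, U u -> psi (phi u) = u].
Proof.
case: fU => U0 [[oU dphi] [psi [[oV dpsi] psiK]]]; exists psi; split=> // u uU.
by apply: psiK; apply: mem_set.
Qed.

Lemma chart_near u : U u -> exists2 r : R, 0 < r & forall v, cabs v < r -> U (u + v).
Proof.
have [psi [oU _ _ _ _]] := chart_inverse.
by move=> uU; apply/nbhs_cabs; apply: open_nbhs_nbhs.
Qed.

Lemma chart_injective u v : U u -> U v -> f (u + a) = f (v + a) -> u = v.
Proof.
have [psi [_ _ _ _ K]] := chart_inverse.
by move=> uU vU; rewrite -!/(phi _) => uv; rewrite -(K u uU) uv K.
Qed.

(** The relation is asked on the whole overlap, and not only near one point, because [U] may be
    disconnected. *)
Lemma nash_map_scale (alpha : C) :
  (forall b, exists2 P, P != 0 & forall u, U u -> U (alpha * u + b) ->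
    relation f a alpha b P u) ->
  locally_nash_map (translates f a U) (translates f a U) (fun z => alpha * z).
Proof.
move=> rel _ _ [c _ <-] [d _ <-] /=; pose b := alpha * c - d.
have [psi [oU oV dphi dpsi psiK]] := chart_inverse.
pose h y := phi (alpha * psi y + b).
pose A := [set u | U u /\ U (alpha * u + b)].
exists h; set D := (X in locally_nash_on X).
have DE : D = phi @` A.
  apply/seteqP; split=> [_ [x [xU gx] <-]|_ [u [uU gu] <-]].
    exists (x - c) => //; split=> //.
    by rewrite (_ : _ + b = alpha * x - d) // /b; ring.
  exists (u + c); rewrite /= ?addrK //; split=> //=.
  by rewrite (_ : _ - d = alpha * u + b) // /b; ring.
have near u : A u -> exists2 r : R, 0 < r & forall v, cabs v < r -> D (phi u + v).
  move=> [uU gU]; have phiu : (phi @` U) (phi u) by exists u.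
  have dg : derivable (fun y => alpha * psi y + b) (phi u) 1.
    exact: derivable_affine_of (dpsi _ phiu).
  have /(derivable_cts dg)[r r0 rP] : nbhs (alpha * psi (phi u) + b) U.
    by rewrite psiK //; apply: open_nbhs_nbhs.
  have /nbhs_cabs[s s0 sP] : nbhs (phi u) (phi @` U) by apply: open_nbhs_nbhs.
  exists (Num.min r s); first by rewrite lt_min r0.
  move=> v; rewrite lt_min => /andP[vr /sP[x xU xE]].
  rewrite DE; exists x => //; split=> //.
  by have := rP v vr; rewrite -xE psiK.
split; last first.
  move=> x xU gxU; rewrite /h -/(phi (x - c)) psiK // /phi.
  by congr f; rewrite /b; ring.
split.
  split; first by apply: open_cabs => y; rewrite {1}DE => -[u uA <-]; apply: near.
  move=> y; rewrite DE => -[u [uU gU] <-]; rewrite /h.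
  have phiu : (phi @` U) (phi u) by exists u.
  apply: (@derivable_comp (fun y => alpha * psi y + b) phi).
    exact: derivable_affine_of (dpsi _ phiu).
  by rewrite psiK //; apply: dphi.
move=> y; rewrite DE => -[u uA <-]; have [P P0 PE] := rel b.
exists P => //; apply/nbhs_cabs; have [r r0 rD] := near u uA.
exists r => // v /rD; rewrite DE => -[x [xU gxU] <-].
by rewrite /h psiK //; apply: PE.
Qed.

Lemma nash_aut_scale (alpha : C) : alpha != 0 ->
  (forall b, exists2 P, P != 0 & forall u, U u -> U (alpha * u + b) ->
    relation f a alpha b P u) ->
  (forall b, exists2 P, P != 0 & forall u, U u -> U (alpha^-1 * u + b) ->
    relation f a alpha^-1 b P u) ->
  locally_nash_aut (translates f a U) (fun z => alpha * z).
Proof.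
move=> a0 h1 h2; split; first by move=> x y; rewrite mulrDr.
exists (fun z => alpha^-1 * z); split; try exact: nash_map_scale.
- by move=> z; rewrite mulKf.
- by move=> z; rewrite mulVKf.
Qed.

Lemma nash_aut_linear g : locally_nash_aut (translates f a U) g ->
  exists alpha, [/\ alpha != 0, forall z, g z = alpha * z &
    exists P (r : R), [/\ P != 0, 0 < r & forall u, cabs u < r ->
      [/\ U u, U (alpha * u) & relation f a alpha 0 P u]]].
Proof.
move=> [gD [g' [gK g'K gN _]]].
have U0 : U 0 by case: fU.
have [psi [oU oV dphi dpsi psiK]] := chart_inverse.
have g0 : g 0 = 0 by apply: (@addrI _ (g 0)); rewrite -gD !addr0.
have ch : translates f a U (Chart [set x | U (x - 0)] (fun x => f (x - 0 + a))).
  by exists 0.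
have [h [[[oD dh] hP] hE]] := gN _ _ ch ch.
set D := (X in open X) in oD dh hP; rewrite /= in hE.
have DE : D = phi @` [set u | U u /\ U (g u)].
  by apply/seteqP; split=> [_ [x [xU gxU] <-]|_ [x [xU gxU] <-]];
     exists x; rewrite /= ?subr0 // in xU gxU *; rewrite ?subr0.
have hphi u : U u -> U (g u) -> h (phi u) = phi (g u).
  by move=> uU guU; have := hE u; rewrite !subr0; apply.
have D0 : D (phi 0) by rewrite DE; exists 0; rewrite /= ?g0.
(* No continuity of [g] is known yet: that it sends a neighbourhood of 0 into [U] comes from the
   openness of the domain [D] of its chart expression. *)
have [r r0 rD] : exists2 r : R, 0 < r & forall u, cabs u < r -> U u /\ U (g u).
  have /(derivable_cts (dphi 0 U0))[s s0 sP] : nbhs (phi 0) D by apply: open_nbhs_nbhs.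
  have [t t0 tP] := chart_near U0.
  exists (Num.min s t); first by rewrite lt_min s0.
  move=> u; rewrite lt_min => /andP[us ut]; have := tP u ut; rewrite add0r => uU.
  split=> //; have := sP u us; rewrite add0r DE => -[x [xU gxU] xu].
  by rewrite -(chart_injective xU uU xu).
have gE u : cabs u < r -> psi (h (phi u)) = g u.
  by move=> /rD[uU guU]; rewrite hphi // psiK.
have dg : derivable g 0 1.
  apply: (near_eq_derivable (f := psi \o (h \o phi))).
    by apply/nbhs_cabs; exists r => // u ur; rewrite add0r /= gE.
  apply: (@derivable_comp (h \o phi) psi).
    by apply: (@derivable_comp phi h); [exact: dphi|exact: dh].
  by rewrite /= hphi ?g0 //; apply: dpsi; exists 0.
have [alpha gA] := additive_derivable gD dg; exists alpha; split=> //.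
  apply/eqP => alpha0; have := gK 1; rewrite gA alpha0 mul0r => g'0.
  have := gK 0; rewrite gA mulr0 g'0 => /eqP; by rewrite oner_eq0.
have [P P0 Pnear] := hP _ D0.
have [s s0 sP] := derivable_cts (dphi 0 U0) Pnear.
exists P, (Num.min r s); split=> //; first by rewrite lt_min r0.
move=> u; rewrite lt_min => /andP[/rD[uU guU] /sP]; rewrite add0r hphi // gA => Pu.
by rewrite -gA; split=> //; rewrite /relation addr0.
Qed.

End Chart.

(** The isomorphism is [alpha |-> (z |-> alpha * z)]. Both directions of each homothety must be
    locally Nash, whence the stability of [K] under inversion. *)
Lemma Aut_isog_units_scale f (K : set C) :
  (forall x, (K `\ 0) x -> (K `\ 0) x^-1) ->
  (forall a U alpha, chart_at_origin f a U -> alpha != 0 ->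
    (exists P (r : R), [/\ P != 0, 0 < r & forall u, cabs u < r ->
      [/\ U u, U (alpha * u) & relation f a alpha 0 P u]]) -> K alpha) ->
  (forall a U alpha b, chart_at_origin f a U -> (K `\ 0) alpha ->
    exists2 P, P != 0 & forall u, U u -> U (alpha * u + b) ->
    relation f a alpha b P u) ->
  Aut_isog_units f K.
Proof.
move=> Kinv autK Kaut a U fU; exists (fun alpha z => alpha * z); split; last first.
  by move=> x y _ _; apply/funext => z; rewrite /= mulrA.
split.
- move=> x Kx; apply: nash_aut_scale => //; first by apply/eqP; case: Kx.
    by move=> b; apply: Kaut.
  by move=> b; apply: Kaut => //; apply: Kinv.
- by move=> x y _ _ /(congr1 (fun g => g 1)); rewrite !mulr1.
- move=> g /(nash_aut_linear fU)[alpha [alpha0 gA relP]].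
  exists alpha; last by apply/funext => z; rewrite gA.
  by split; [apply: autK fU alpha0 relP|apply/eqP].
Qed.

End Automorphisms.

(** * The exponential structure *)

Section ExponentialCase.
Variable R : realType.
Local Notation C := (Cplx R).
Implicit Types (a b z u : C) (U : set C).

Lemma Aut_isog_units_id : Aut_isog_units (fun u : C => u) [set: C].
Proof.
apply: Aut_isog_units_scale => [x [_ x0]|//|a U alpha b _ _].
  by split=> // /eqP; rewrite invr_eq0 => /eqP.
exists ('X - (alpha *: 'X + (b + a - alpha * a)%:P)%:P); first by rewrite polyXsubC_eq0.
by move=> u _ _; rewrite /relation !hornerE /=; ring.
Qed.

Lemma cexpD x y : cexp (x + y) = cexp x * cexp y :> C.
Proof.
case: x y => [x1 x2] [y1 y2]; apply/eqP; rewrite eq_complex /=.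
by rewrite expRD cosD sinD; apply/andP; split; apply/eqP; ring.
Qed.

Lemma cexp0 : cexp 0 = 1 :> C.
Proof.
by apply/eqP; rewrite eq_complex /= expR0 cos0 sin0 mulr0 mulr1 !eqxx.
Qed.

Lemma cexp_neq0 z : cexp z != 0.
Proof.
apply/eqP => z0; have /eqP : 1 = 0 :> C; last by rewrite oner_eq0.
by rewrite -[LHS]cexp0 -[X in cexp X](subrr z) cexpD z0 mul0r.
Qed.

Lemma cexpMn n z : cexp (n%:R * z) = cexp z ^+ n.
Proof.
elim: n => [|n IHn]; first by rewrite mul0r cexp0 expr0.
by rewrite -natr1 mulrDl mul1r cexpD IHn exprSr.
Qed.

(* Dedekind's argument for the independence of characters, near the origin. *)
Lemma cexp_independent (I : eqType) (s : seq I) (c lambda : I -> C) (r rho : R) :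
  0 < r -> 0 < rho -> (forall z, z != 0 -> cabs z < rho -> cexp z != 1) ->
  uniq s -> {in s &, injective lambda} ->
  (forall u, cabs u < r -> \sum_(i <- s) c i * cexp (lambda i * u) = 0) ->
  {in s, forall i, c i = 0}.
Proof.
move=> r0 rho0 E1; elim: s c r r0 => [//|i0 s IHs] c r r0 /= /andP[i0s us] linj c0.
have linj' : {in s &, injective lambda}.
  by move=> i j si sj; apply: linj; rewrite inE ?si ?sj orbT.
have cs : {in s, forall i, c i = 0}.
  move=> i si; pose l := lambda i - lambda i0.
  have l0 : l != 0.
    rewrite subr_eq0; apply: contraNneq i0s => li.
    by rewrite -(linj _ _ _ _ li) // inE ?eqxx ?si ?orbT.
  have cl0 : 0 < cabs l by rewrite cabs_gt0.
  (* The increment [v] will be [t / 2], so that [u + v] stays within [r], and [l * v] within [rho],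
     where [cexp] takes the value 1 only at 0. *)
  pose t := Num.min (r / 2) (rho / (2 * cabs l)).
  have t0 : 0 < t by rewrite lt_min !divr_gt0 ?mulr_gt0.
  have tr : t <= r / 2 by rewrite ge_min lexx.
  have tl : t * cabs l < rho.
    apply: le_lt_trans (_ : rho / 2 < _); last by lra.
    have -> : rho / 2 = rho / (2 * cabs l) * cabs l by field; rewrite lt0r_neq0.
    by rewrite ler_wpM2r ?cabs_ge0 // ge_min lexx orbT.
  have [|] := boolP (c i == 0); first by move/eqP.
  pose v : C := (t / 2)%:C%C; have v0 : v != 0.
    by rewrite -cabs_eq0 cabs_real normr_eq0 mulf_neq0 ?lt0r_neq0 // invr_gt0.
  have cv : cabs v = t / 2 by rewrite cabs_real gtr0_norm // divr_gt0.
  have := IHs (fun j => c j * (cexp (lambda j * v) - cexp (lambda i0 * v))) (r / 2)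
    (divr_gt0 r0 (ltr0n _ 2)) us linj'.
  move=> /(_ _ i si) h; have /eqP : c i * (cexp (lambda i * v) - cexp (lambda i0 * v)) = 0.
    apply: h => u ur.
    have h1 : cabs (u + v) < r.
      by apply: le_lt_trans (cabsD _ _) _; rewrite cv; lra.
    have h2 : cabs u < r by lra.
    (* The relation at [u + v] minus a multiple of the one at [u]: the term of [i0] cancels and the
       others get the coefficients given to [IHs]. *)
    have : \sum_(i <- i0 :: s) c i * cexp (lambda i * (u + v)) -
        cexp (lambda i0 * v) * \sum_(i <- i0 :: s) c i * cexp (lambda i * u) = 0.
      by rewrite (c0 _ h1) (c0 _ h2) mulr0 subrr.
    rewrite mulr_sumr -sumrB big_cons mulrDr cexpD (_ : _ - _ = 0) ?add0r; last by ring.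
    move=> h0; rewrite -[RHS]h0; apply: eq_bigr => j _.
    by rewrite [lambda j * (u + v)]mulrDr cexpD; ring.
  rewrite mulf_eq0 => /orP[-> //|].
  rewrite subr_eq0 => /eqP hE.
  have /eqP[] : cexp (l * v) != 1.
    apply: E1; first exact: mulf_neq0.
    by rewrite cabsM cv mulrC; apply: le_lt_trans tl; rewrite ler_wpM2r ?cabs_ge0 //; lra.
  apply: (mulIf (cexp_neq0 (lambda i0 * v))).
  by rewrite -cexpD mul1r -hE /l; congr cexp; ring.
move=> i; rewrite inE => /orP[/eqP->|/cs//].
have := c0 0; rewrite cabs0 => /(_ r0); rewrite big_cons big_seq big1 ?addr0.
  by rewrite mulr0 cexp0 mulr1.
by move=> j sj; rewrite cs ?mul0r.
Qed.

Lemma rationalsV x : (rationals (R := R) `\ 0) x -> (rationals (R := R) `\ 0) x^-1.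
Proof.
move=> [[q _ <-] /eqP x0]; split; first by exists q^-1; rewrite // fmorphV.
by apply/eqP; rewrite invr_eq0.
Qed.

Lemma Aut_isog_units_cexp : Aut_isog_units (@cexp R) (@rationals R).
Proof.
apply: Aut_isog_units_scale => [|a U alpha aU alpha0 [P [r [P0 r0 Prel]]]|].
- exact: rationalsV.
- have U0 : U 0 by case: aU.
  have [rho rho0 rhoP] := chart_near aU U0.
  (* Injectivity of the chart supplies the isolation of the zero of [cexp z - 1] at 0. *)
  have E1 z : z != 0 -> cabs z < rho -> cexp z != 1.
    move=> z0 zr; apply: contraNneq z0 => Ez; apply/eqP.
    apply: (chart_injective aU _ U0); first by rewrite -(add0r z); apply: rhoP.
    by rewrite cexpD Ez mul1r add0r.
  apply: contrapT => nK; move/eqP: P0; apply.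
  have us : uniq (bidegrees P).
    by apply: allpairs_uniq; rewrite ?iota_uniq // => -[? ?] [? ?].
  pose lambda (k : nat * nat) : C := k.1%:R + k.2%:R * alpha.
  (* If two exponents coincide, [alpha] is a quotient of differences of integers, contrary to
     [nK]. *)
  have linj : injective lambda.
    move=> [i j] [i' j'] /eqP; rewrite /lambda /= -subr_eq0 => /eqP e.
    have [jj|jj] := eqVneq j j'.
      by move: e; rewrite jj opprD addrACA subrr addr0 => /eqP; rewrite subr_eq0 eqr_nat => /eqP->.
    case: nK; exists ((i'%:R - i%:R) / (j%:R - j'%:R)) => //.
    have jj0 : j%:R - j'%:R != 0 :> C by rewrite subr_eq0 eqr_nat.
    rewrite fmorph_div !rmorphB /= !ratr_nat.
    apply: (mulIf jj0); rewrite divfK //; apply/eqP; rewrite -subr_eq0 -oppr_eq0 -e.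
    by apply/eqP; ring.
  apply: bidegrees_eq0 => k ks; apply/eqP.
  have := @cexp_independent _ (bidegrees P)
    (fun k => P`_(k.2)`_(k.1) * cexp ((k.1%:R + k.2%:R) * a))
    lambda r rho r0 rho0 E1 us (in2W linj).
  move=> /(_ _ k ks) h; have /eqP : P`_(k.2)`_(k.1) * cexp ((k.1%:R + k.2%:R) * a) = 0.
    apply: h => u /Prel[_ _]; rewrite /relation bivariate_horner => h0.
    rewrite -[RHS]h0; apply: eq_bigr => -[i j] _ /=; rewrite -mulrA -!cexpMn -!cexpD; congr (_ * cexp _).
    by rewrite /lambda /=; ring.
  by rewrite mulf_eq0 (negbTE (cexp_neq0 _)) orbF.
move=> a U _ b aU [[q _ <-] _].
have [n [d [d0 qd]]] : exists (n : int) (d : nat),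
    (0 < d)%N /\ ratr q * d%:R = n%:~R :> C.
  exists (numq q), `|denq q|%N; split; first by rewrite absz_gt0 denq_neq0.
  by rewrite /ratr pmulrn absz_denq divfK // intr_eq0 denq_neq0.
have dM u : cexp (ratr q * u + b + a) ^+ d = cexp (n%:~R * u + d%:R * (b + a)) :> C.
  by rewrite -cexpMn; congr cexp; rewrite -qd; ring.
(* For [q = n / d] the relation is [Y ^ d = c * X ^ n] if [n] is nonnegative, and
   [X ^ (- n) * Y ^ d = c] otherwise. *)
case: n {qd} dM => m dM.
  pose c : C := cexp (d%:R * (b + a) - m%:R * a).
  exists ('X^d - (c *: 'X^m)%:P); last first.
    move=> u _ _; rewrite /relation !hornerE dM -cexpMn -cexpD -pmulrn.
    by apply/eqP; rewrite subr_eq0; apply/eqP; congr cexp; ring.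
  by rewrite -size_poly_eq0 size_XnsubC.
pose c : C := cexp (d%:R * (b + a) + m.+1%:R * a).
have {}dM u : cexp (ratr q * u + b + a) ^+ d =
    cexp (- (m.+1%:R * u) + d%:R * (b + a)) :> C.
  by rewrite dM NegzE mulrNz mulNr -pmulrn.
exists (('X^(m.+1))%:P * 'X^d - c%:P%:P); last first.
  move=> u _ _; rewrite /relation polymul_horner hornerXn.
  apply/eqP; rewrite subr_eq0; apply/eqP.
  apply: etrans (congr1 ( *%R (cexp (u + a) ^+ m.+1)) (dM u)) _.
  by rewrite -(cexpMn m.+1) -cexpD; congr cexp; ring.
by apply: polymul_neq0; rewrite // -size_poly_eq0 size_polyXn.
Qed.

End ExponentialCase.

(** * The field of multipliers of a lattice *)

Section Multipliers.
Variable R : realType.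
Local Notation C := (Cplx R).
Variable w : C.
Hypothesis wnr : w \isn't Num.real.
Local Notation pt := (lattice_pt w).

Definition in_lattice (z : C) := exists k, z = pt k.

Lemma in_latticeB x y : in_lattice x -> in_lattice y -> in_lattice (x - y).
Proof. by move=> [k ->] [l ->]; exists (k.1 - l.1, k.2 - l.2); rewrite lattice_ptB. Qed.

Lemma in_lattice_int (m : int) x : in_lattice x -> in_lattice (m%:~R * x).
Proof.
move=> [k ->]; exists (m * k.1, m * k.2).
by rewrite /lattice_pt !intrM mulrDr mulrA.
Qed.

Lemma in_lattice_nat (n : nat) x : in_lattice x -> in_lattice (n%:R * x).
Proof. by rewrite pmulrn; apply: in_lattice_int. Qed.

Lemma in_lattice0 : in_lattice 0.
Proof. by exists (0, 0); rewrite /lattice_pt mul0r addr0. Qed.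

Lemma in_latticeN x : in_lattice x -> in_lattice (- x).
Proof. by rewrite -sub0r; apply: in_latticeB; apply: in_lattice0. Qed.

Lemma in_latticeD x y : in_lattice x -> in_lattice y -> in_lattice (x + y).
Proof. by move=> Lx Ly; rewrite -[y]opprK; apply: in_latticeB => //; apply: in_latticeN. Qed.

Lemma in_lattice_pt k : in_lattice (pt k). Proof. by exists k. Qed.

Lemma in_lattice1 : in_lattice 1.
Proof. by exists (1, 0); rewrite /lattice_pt mul0r addr0. Qed.

Lemma in_lattice_w : in_lattice w.
Proof. by exists (0, 1); rewrite /lattice_pt mul1r add0r. Qed.

Definition preserves (c : C) := in_lattice c /\ in_lattice (c * w).

Lemma preservesP c z : preserves c -> in_lattice z -> in_lattice (c * z).
Proof.
move=> [c1 cw] [[m n] ->]; rewrite /lattice_pt /= mulrDr.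
by apply: in_latticeD; rewrite mulrC -?mulrA; apply: in_lattice_int; rewrite // mulrC.
Qed.

Lemma preserves_lattice c : (forall z, in_lattice z -> in_lattice (c * z)) -> preserves c.
Proof.
move=> h; split; last by apply: h; apply: in_lattice_w.
by rewrite -[c]mulr1; apply: h; apply: in_lattice1.
Qed.

Lemma preservesM c d : preserves c -> preserves d -> preserves (c * d).
Proof.
move=> pc pd; apply: preserves_lattice => z Lz; rewrite -mulrA.
by apply: preservesP => //; apply: preservesP.
Qed.

Lemma preservesB c d : preserves c -> preserves d -> preserves (c - d).
Proof.
move=> pc pd; apply: preserves_lattice => z Lz; rewrite mulrBl.
by apply: in_latticeB; apply: preservesP.
Qed.

Lemma preserves_int (m : int) : preserves m%:~R.
Proof. by apply: preserves_lattice => z; apply: in_lattice_int. Qed.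

Lemma preserves_nat (n : nat) : preserves n%:R.
Proof. by apply: preserves_lattice => z; apply: in_lattice_nat. Qed.

(** These are the elements of the endomorphism ring of the lattice tensored with the rationals. *)
Definition multiplier (c : C) := exists2 q : nat, (0 < q)%N & preserves (q%:R * c).

Lemma multiplier_of_int c (m : int) : m != 0 -> preserves (m%:~R * c) -> multiplier c.
Proof.
case: m => n n0 pm; first by exists n; rewrite ?lt0n.
exists n.+1 => //; have := preservesM (preserves_int (-1)) pm.
by rewrite NegzE mulrA -intrM mulN1r opprK -pmulrn.
Qed.

Lemma multiplierV x : multiplier x -> multiplier x^-1.
Proof.
have [->|x0 [q q0 pq]] := eqVneq x 0; first by rewrite invr0.
have qC : q%:R != 0 :> C by rewrite pnatr_eq0 -lt0n.
have [[[m n] e1] [[m' n'] e2]] := pq; rewrite /lattice_pt /= in e1 e2.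
set y := q%:R * x in e1 e2 pq; have y0 : y != 0 by rewrite mulf_neq0.
pose D := m * n' - n * m'.
(* Cayley-Hamilton: [y] acts on the basis [1, w] by an integer matrix of trace [m + n'] and
   determinant [D], so [x^-1] is [q * (trace - y) / D]. *)
have CH : y * ((m + n')%:~R - y) = D%:~R.
  have : y * y = m%:~R * y + n%:~R * (y * w) by rewrite {2}e1; ring.
  have : n%:~R * w = y - m%:~R by rewrite e1; ring.
  rewrite e2 mulrDr [n%:~R * (_ * w)]mulrCA => -> h.
  by rewrite mulrBr h /D !(intrD, intrB, intrM); ring.
(* Otherwise [y] equals its trace; comparing coordinates then gives [m = n' = 0], hence [y = 0]. *)
have D0 : D != 0.
  apply: contraNneq y0 => D0; move: CH; rewrite D0 => /eqP.
  rewrite mulf_eq0 => /orP[//|]; rewrite subr_eq0 => /eqP ye.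
  have [h1 h2] : (m + n', 0) = (m, n) :> (int * int).
    by apply: (lattice_inj wnr); rewrite /lattice_pt /= mul0r addr0 ye e1.
  have [h3 h4] : (0, m + n') = (m', n') :> (int * int).
    by apply: (lattice_inj wnr); rewrite /lattice_pt /= add0r ye e2.
  have mn0 : m + n' = 0 by move: h1 h4; clear; lia.
  by rewrite -ye mn0.
apply: (@multiplier_of_int _ D) => //.
have -> : D%:~R * x^-1 = q%:R * ((m + n')%:~R - y).
  by rewrite -CH /y; field.
by apply: preservesM; [exact: preserves_nat|apply: preservesB => //; exact: preserves_int].
Qed.

Lemma multiplierM x y : multiplier x -> multiplier y -> multiplier (x * y).
Proof.
move=> [q q0 pq] [r r0 pr]; exists (q * r)%N; first by rewrite muln_gt0 q0.
by rewrite natrM mulrACA; apply: preservesM.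
Qed.

Lemma multiplierB x y : multiplier x -> multiplier y -> multiplier (x - y).
Proof.
move=> [q q0 pq] [r r0 pr]; exists (q * r)%N; first by rewrite muln_gt0 q0.
have -> : (q * r)%:R * (x - y) = r%:R * (q%:R * x) - q%:R * (r%:R * y) :> C.
  by rewrite natrM; ring.
by apply: preservesB; apply: preservesM => //; apply: preserves_nat.
Qed.

Lemma multiplier1 : multiplier 1.
Proof. by exists 1%N; rewrite // mulr1; apply: preserves_nat. Qed.

Lemma multiplier_divring :
  GRing.divring_closed [pred z : C | `[< multiplier z >] ].
Proof.
split=> [|x y /asboolP mx /asboolP my|x y /asboolP mx /asboolP my]; apply/asboolP.
- exact: multiplier1.
- exact: multiplierB.
- by apply: multiplierM => //; apply: multiplierV.
Qed.

(** After clearing denominators, [q2 * w * w] is an integer combination of 1 and [w], so [q2 * w]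
    preserves the lattice. *)
Lemma multiplier_quadratic : quadratic w -> multiplier w.
Proof.
move=> [p [_ sp pw]]; have [q [c c0 pE]] := rat_poly_scale p.
have c0' : (c%:~R : rat)^-1 != 0 by rewrite invr_eq0 intr_eq0.
have sq : size q = 3%N.
  by rewrite -sp pE size_scale // size_map_inj_poly // => x y /eqP; rewrite eqr_int => /eqP.
have qw : root (map_poly intr q) w.
  move: pw; rewrite pE map_polyZ rootZ ?fmorph_eq0 // -map_poly_comp.
  rewrite (eq_map_poly (g := intr)) // => m; exact: ratr_int.
have q2 : q`_2 != 0 by have := lead_coefE q; rewrite sq => <-; rewrite lead_coef_eq0 -size_poly_eq0 sq.
have qE : (q`_2)%:~R * w * w = - ((q`_1)%:~R * w + (q`_0)%:~R).
  move: qw; rewrite /root (@horner_coef_wide _ 3); last first.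
    by rewrite (leq_trans (size_poly _ _)) // sq.
  rewrite !big_ord_recr big_ord0 /= !coef_map /= expr0 mulr1 add0r expr1 => /eqP h.
  by apply/eqP; rewrite -subr_eq0 opprK -h; apply/eqP; ring.
apply: (multiplier_of_int q2); split.
  by apply: in_lattice_int; apply: in_lattice_w.
rewrite qE; apply: in_latticeN; apply: in_latticeD.
  by apply: in_lattice_int; apply: in_lattice_w.
by rewrite -[X in in_lattice X]mulr1; apply: in_lattice_int; apply: in_lattice1.
Qed.

Lemma multiplier_rational (x : rat) : multiplier (ratr x).
Proof.
apply: (@multiplier_of_int _ (denq x)); first exact: denq_neq0.
by rewrite /ratr mulrC divfK ?intr_eq0 ?denq_neq0 //; apply: preserves_int.
Qed.

Lemma K_multiplier x : K_ w x -> multiplier x.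
Proof.
rewrite /K_; case: asboolP => [qw /(_ _ multiplier_divring)|_ [q _ <-]].
  by move=> h; apply/asboolP; apply: h; apply/asboolP/multiplier_quadratic.
exact: multiplier_rational.
Qed.

Lemma ratr_real (x : rat) : (ratr x : C) \is Num.real.
Proof. by rewrite /ratr rpred_div ?rpred_int. Qed.

(** A rational root would make the other root rational too, hence [w] real; in degree 2, having no
    root means irreducible. *)
Lemma quadratic_intro (a b c : int) : a != 0 ->
  a%:~R * w ^+ 2 + b%:~R * w + c%:~R = 0 -> quadratic w.
Proof.
move=> a0 aw; pose p : {poly rat} := Poly [:: c%:~R; b%:~R; a%:~R].
have a0' : a%:~R != 0 :> rat by rewrite intr_eq0.
have pE : p = [:: c%:~R; b%:~R; a%:~R] :> seq rat by rewrite (@PolyK _ 0).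
have sp : size p = 3%N by rewrite pE.
have pH (x : C) : (map_poly ratr p).[x] = a%:~R * x ^+ 2 + b%:~R * x + c%:~R.
  rewrite (@horner_coef_wide _ 3); last by rewrite (leq_trans (size_poly _ _)) // sp.
  rewrite !big_ord_recr big_ord0 /= !coef_map pE /= !ratr_int; ring.
exists p; split=> //; last by rewrite /root pH aw.
apply: cubic_irreducible => [|x]; first by rewrite sp.
apply/negP => px.
have : a%:~R * ratr x ^+ 2 + b%:~R * ratr x + c%:~R = 0 :> C.
  by rewrite -pH horner_map (rootP px) rmorph0.
rewrite -aw => /eqP; rewrite -subr_eq0.
have -> : a%:~R * ratr x ^+ 2 + b%:~R * ratr x + c%:~R -
  (a%:~R * w ^+ 2 + b%:~R * w + c%:~R) =
  (ratr x - w) * (a%:~R * (ratr x + w) + b%:~R) by ring.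
have aC : a%:~R != 0 :> C by rewrite intr_eq0.
rewrite mulf_eq0 => /orP[|]; apply/negP.
  by rewrite subr_eq0; apply: contraNneq wnr => <-; apply: ratr_real.
apply: contraNneq wnr => /eqP; rewrite mulrDr -addrA addr_eq0 => /eqP h.
have -> : w = - (b%:~R / a%:~R) - ratr x.
  by apply: (mulfI aC); rewrite mulrBr mulrN mulrCA divff // mulr1 h; ring.
by rewrite rpredB ?rpredN ?rpred_div ?rpred_int ?ratr_real.
Qed.

Lemma divring_lattice (S : {pred C}) : GRing.divring_closed S -> w \in S ->
  forall k, pt k \in S.
Proof.
move=> [S1 SB SV] wS [m n].
have S0 : 0 \in S by rewrite -(subrr 1); apply: SB.
have SN x : x \in S -> - x \in S by move=> Sx; rewrite -sub0r; apply: SB.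
have SD x y : x \in S -> y \in S -> x + y \in S.
  by move=> Sx Sy; rewrite -[y]opprK; apply: SB => //; apply: SN.
have SM x y : x \in S -> y \in S -> x * y \in S.
  by move=> Sx Sy; rewrite -[y]invrK; apply: (SV) => //; rewrite -div1r; apply: SV.
have Snat k : (k%:R : C) \in S.
  by elim: k => [//|k IHk]; rewrite -natr1; apply: SD.
have Sint (k : int) : (k%:~R : C) \in S.
  by case: k => k; rewrite ?NegzE ?mulrNz -?pmulrn //; apply: SN.
by apply: SD => //; apply: SM.
Qed.

(** From [q * x = m + n * w] and [q * x * w = m' + n' * w] follows
    [n * w ^+ 2 + (m - n') * w - m' = 0]; so if [w] is not quadratic, then [n = 0] and [x] is
    rational. *)
Lemma multiplier_K x : multiplier x -> K_ w x.
Proof.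
move=> [q q0 [[[m n] e1] [[m' n'] e2]]].
have qC : q%:R != 0 :> C by rewrite pnatr_eq0 -lt0n.
rewrite /K_; case: asboolP => [_ S dS wS|nqw].
  have -> : x = pt (m, n) / pt (q%:Z, 0).
    by rewrite -e1 /lattice_pt /= mul0r addr0 -pmulrn mulrC mulKf.
  by case: (dS) => _ _; apply; apply: divring_lattice.
have [n0|n0] := eqVneq n 0.
  exists (m%:~R / q%:R) => //; apply: (mulfI qC).
  by rewrite fmorph_div /= ratr_int ratr_nat mulrC divfK // e1 n0 /lattice_pt /= mul0r addr0.
case: nqw; apply: (@quadratic_intro n (m - n') (- m')) => //.
move: e1 e2; rewrite /lattice_pt /= => -> e2.
rewrite intrB intrN (_ : _ + _ = (m%:~R + n%:~R * w) * w - (m'%:~R + n'%:~R * w)).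
  by rewrite e2 subrr.
by ring.
Qed.

End Multipliers.

(** * The Weierstrass structure *)

Section WeierstrassCase.
Variable R : realType.
Local Notation C := (Cplx R).
Variable w : C.
Hypothesis wnr : w \isn't Num.real.
Local Notation pt := (lattice_pt w).
Local Notation wp := (weierstrass_p w).
Local Notation inL := (in_lattice w).

(** A chart is continuous, hence bounded near each of its points, whereas [wp] is unbounded near the
    lattice despite its finite values on it. *)
Lemma chart_avoids_lattice a (U : set C) u k :
  chart_at_origin wp a U -> U u -> pt k != u + a.
Proof.
move=> aU uU; apply/eqP => ku.
have [psi [_ _ dphi _ _]] := chart_inverse aU.
have : nbhs (wp (u + a)) [set y | cabs (y - wp (u + a)) < 1].
  by apply/nbhs_cabs; exists 1 => // v v1; rewrite /= addrC addKr.
move=> /(derivable_cts (dphi u uU))[r r0 rP].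
apply: (@wp_unbounded _ _ wnr k (1 + cabs (wp (u + a))) r r0) => v vr.
have : cabs (wp (u + v + a) - wp (u + a)) < 1 := rP v vr.
rewrite [u + v + a]addrAC -ku => /ltW h.
have := cabsD (wp (pt k + v) - wp (pt k)) (wp (pt k)); rewrite subrK => h'.
by apply: le_trans h' _; rewrite lerD2r.
Qed.

(** If [N / g] preserves the lattice, reducing both indices modulo [N] moves a pole by a period, so
    [N ^ 2] representatives suffice. *)
Lemma pole_list (g c : C) : g != 0 -> multiplier w g -> exists L : seq C,
  [/\ (0 < size L)%N, forall p, p \in L -> exists k, pt k = g * p + c &
      forall z, (exists k, pt k = g * z + c) -> exists l, z + pt l \in L].
Proof.
move=> g0 mg; have [N N0 pN] := multiplierV wnr mg.
pose L := [seq (pt (i%:Z, j%:Z) - c) / g | i <- iota 0 N, j <- iota 0 N].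
exists L; split.
- by rewrite size_allpairs size_iota muln_gt0 N0.
- move=> p /allpairsP[[i j] [_ _ ->]]; exists (i%:Z, j%:Z).
  by rewrite mulrC divfK // subrK.
move=> z [[m n] kz].
pose d := ((m %/ N%:Z)%Z, (n %/ N%:Z)%Z).
have [l lE] := preservesP pN (in_lattice_pt w d).
have NZ : N%:Z != 0 by rewrite eqz_nat -lt0n.
have modN (x : int) : exists2 i : nat, (i < N)%N & (x %% N%:Z)%Z = i%:Z.
  exists `|(x %% N%:Z)%Z|%N; last by rewrite gez0_abs // modz_ge0.
  by rewrite -ltz_nat gez0_abs ?modz_ge0 // ltz_mod.
have [i iN iE] := modN m; have [j jN jE] := modN n.
exists (- l.1, - l.2).
have -> : z + pt (- l.1, - l.2) = (pt (i%:Z, j%:Z) - c) / g.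
  rewrite lattice_ptN.
  rewrite -lE; have -> : z = (pt (m, n) - c) / g by rewrite kz addrK mulrC mulKf.
  have -> : pt (m, n) = N%:R * pt d + pt (i%:Z, j%:Z).
    rewrite {1}(divz_eq m N%:Z) {1}(divz_eq n N%:Z) iE jE /lattice_pt /=.
    by rewrite !intrD !intrM -!pmulrn; ring.
  by field.
by apply: allpairs_f; rewrite mem_iota.
Qed.

Lemma wp_affine_double_pole (g c p : C) : g != 0 ->
  double_pole (fun z => wp (g * z + c)) p.
Proof.
move=> g0; have [h ha [r r0 rP]] := wp_double_pole wnr (g * p + c).
have cg0 : 0 < cabs g by rewrite cabs_gt0.
exists (fun z => g ^- 2 * h (g * z + c)).
  by apply: analytic_mul; [apply: analytic_cst|apply: analytic_affine].
exists (r / cabs g); first by rewrite divr_gt0.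
move=> u u0; rewrite ltr_pdivlMr // => ur.
have -> : g * (p + u) + c = g * p + c + g * u by ring.
rewrite -rP ?mulf_neq0 ?cabsM 1?mulrC //.
by field.
Qed.

Lemma wp_affine_punctured (g c p : C) : g != 0 ->
  punctured p (fun z => forall k, pt k != g * z + c).
Proof.
move=> g0; have [r r0 rP] := lattice_punctured wnr (g * p + c).
have cg0 : 0 < cabs g by rewrite cabs_gt0.
exists (r / cabs g); first by rewrite divr_gt0.
move=> u u0; rewrite ltr_pdivlMr // => ur k.
have -> : g * (p + u) + c = g * p + c + g * u by ring.
by apply: rP; rewrite ?mulf_neq0 // cabsM mulrC.
Qed.

Lemma wp_affine_periodic (g c : C) : preserves w g ->
  lattice_periodic w (fun z => wp (g * z + c)).
Proof.
move=> [[k gk] [l gl]] z.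
have wpl := periodic_lattice (wp_lattice_periodic wnr).
split; rewrite mulrDr addrAC ?mulr1; first by rewrite gk wpl.
by rewrite gl wpl.
Qed.

Lemma wp_affine_dependent (g g' c c' : C) : g != 0 -> g' != 0 ->
  preserves w g -> preserves w g' ->
  exists2 P : {poly {poly C}}, P != 0 & forall z,
    (forall k, pt k != g * z + c) -> (forall k, pt k != g' * z + c') ->
    P.[(wp (g' * z + c'))%:P].[wp (g * z + c)] = 0.
Proof.
move=> g0 g'0 pg pg'.
have mult h : preserves w h -> multiplier w h by move=> ph; exists 1%N; rewrite ?mul1r.
have [L [L0 LS SL]] := pole_list c g0 (mult _ pg).
have [L' [_ LS' SL']] := pole_list c' g'0 (mult _ pg').
pose bad h d z := exists k, pt k = h * z + d.
have badN h d z : ~ bad h d z <-> forall k, pt k != h * z + d.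
  split=> [nb k|nb [k /eqP]]; last exact/negP/nb.
  by apply/eqP => kz; apply: nb; exists k.
have badl h d l z : preserves w h -> bad h d z -> bad h d (z + pt l).
  move=> ph [k kz]; have [m hm] := preservesP ph (in_lattice_pt w l).
  exists (k.1 + m.1, k.2 + m.2); rewrite lattice_ptD -hm kz; ring.
have badE h d l z : preserves w h -> bad h d (z + pt l) <-> bad h d z.
  move=> ph; split; last exact: badl.
  by move=> /(badl _ _ (- l.1, - l.2) _ ph); rewrite lattice_ptN addrK.
have [|||||||||P P0 PE] := @periodic_algebraic R w (fun z => wp (g * z + c))
  (fun z => wp (g' * z + c')) (fun z => bad g c z \/ bad g' c' z) (L ++ L') wnr.
- exact: wp_affine_periodic.
- exact: wp_affine_periodic.
- by move=> k z; rewrite !badE.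
- by rewrite size_cat ltn_addr.
- by move=> p; rewrite mem_cat => /orP[/LS|/LS']; [left|right].
- move=> p [/SL|/SL'] [l lL]; exists l; rewrite mem_cat lL ?orbT //.
- move=> p /not_orP[/badN h /badN h'].
  by split; (apply: analytic_affine; [|apply: wp_analytic]).
- move=> p; apply: punctured_sub (puncturedI (wp_affine_punctured c p g0)
    (wp_affine_punctured c' p g'0)) => z [/badN h /badN h'].
  by apply/not_orP.
- by move=> p _; split; apply: wp_affine_double_pole.
by exists P => // z /badN h /badN h'; apply: PE; apply/not_orP.
Qed.

Lemma wp_relation a (U : set C) alpha b : chart_at_origin wp a U -> alpha != 0 ->
  multiplier w alpha ->
  exists2 P : {poly {poly C}}, P != 0 &
    forall u, U u -> U (alpha * u + b) -> relation wp a alpha b P u.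
Proof.
move=> aU alpha0 [q q0 pq].
have qC : q%:R != 0 :> C by rewrite pnatr_eq0 -lt0n.
have [|P P0 PE] := @wp_affine_dependent _ _ a (b + a) qC _ (preserves_nat w q) pq.
  by rewrite mulf_neq0.
exists P => // u uU guU; rewrite /relation; have := PE (u / q%:R).
have -> : q%:R * (u / q%:R) = u by rewrite mulrC divfK.
have -> : q%:R * alpha * (u / q%:R) + (b + a) = alpha * u + b + a by field.
by apply=> k; apply: chart_avoids_lattice aU _.
Qed.

(** Pigeonhole: among [M ^ 2 + 1] multiples of [z], two fall modulo the lattice into the same of
    [M ^ 2] cells, where points are at most [(1 + cabs w) / M] apart. *)
Lemma dirichlet_lattice (z : C) (eta : R) : 0 < eta ->
  exists (N : nat) (l : int * int), (0 < N)%N /\ cabs (N%:R * z - pt l) < eta.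
Proof.
move=> eta0; pose M := (Num.bound ((1 + cabs w) / eta)).+1.
have M0 : 0 < M%:R :> R by rewrite ltr0n.
have Meta : (1 + cabs w) / M%:R < eta.
  rewrite ltr_pdivrMr // mulrC -ltr_pdivrMr //.
  apply: lt_trans (archi_boundP _) _; last by rewrite ltr_nat.
  by rewrite divr_ge0 ?addr_ge0 ?cabs_ge0 // ltW.
have cell (n : nat) : exists (ij : 'I_M * 'I_M) (st : R * R) (k : int * int),
    [/\ n%:R * z = st.1%:C%C + st.2%:C%C * w + pt k,
        ij.1%:R <= M%:R * st.1 < ij.1.+1%:R & ij.2%:R <= M%:R * st.2 < ij.2.+1%:R].
  have [k [s [t [/andP[s0 s1] /andP[t0 t1] nE]]]] := frac_coord (n%:R * z) wnr.
  have Ms : 0 <= M%:R * s by rewrite mulr_ge0 // ltW.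
  have Mt : 0 <= M%:R * t by rewrite mulr_ge0 // ltW.
  have hs := truncn_itv Ms; have ht := truncn_itv Mt.
  have ls : (Num.truncn (M%:R * s) < M)%N.
    rewrite -(ltr_nat R); case/andP: hs => h _; apply: le_lt_trans h _.
    by rewrite gtr_pMr.
  have lt' : (Num.truncn (M%:R * t) < M)%N.
    rewrite -(ltr_nat R); case/andP: ht => h _; apply: le_lt_trans h _.
    by rewrite gtr_pMr.
  by exists (Ordinal ls, Ordinal lt'), (s, t), k.
have /choice[f fP] := cell.
pose F (i : 'I_(M * M).+1) := f i.
have /injectivePn[i [j ij Fij]] : ~~ injectiveb F.
  apply/negP => /injectiveP/leq_card; rewrite card_prod !card_ord.
  by rewrite ltnn.
wlog lij : i j ij Fij / (i < j)%N.
  move=> H; case: (ltngtP i j) => [h|h|/val_inj h]; first exact: (H i j).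
    by apply: (H j i) => //; rewrite eq_sym.
  by rewrite h eqxx in ij.
have [[s t] [k [zi si ti]]] := fP i; have [[s' t'] [k' [zj sj tj]]] := fP j.
exists (j - i)%N, (k'.1 - k.1, k'.2 - k.2); split; first by rewrite subn_gt0.
have -> : (j - i)%:R * z - pt (k'.1 - k.1, k'.2 - k.2) =
    (s' - s)%:C%C + (t' - t)%:C%C * w.
  rewrite natrB ?(ltnW lij) // lattice_ptB mulrBl zi zj /= !rmorphB /=; ring.
move: Fij; rewrite /F => Fij; rewrite /= -Fij in sj tj; rewrite /= in si ti.
have near (x y : R) (n : nat) : n%:R <= M%:R * x < n.+1%:R ->
    n%:R <= M%:R * y < n.+1%:R -> `|y - x| <= M%:R^-1.
  rewrite -natr1 => /andP[h1 h2] /andP[h3 h4].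
  rewrite -(ler_pM2l M0) mulfV ?lt0r_neq0 // -[M%:R in leLHS]gtr0_norm // -normrM.
  by rewrite mulrBr ler_norml; apply/andP; split; lra.
apply: le_lt_trans Meta; apply: le_trans (cabsD _ _) _.
rewrite cabsM !cabs_real mulrDl mul1r; apply: lerD; first exact: near si sj.
by rewrite mulrC ler_wpM2l ?cabs_ge0 //; apply: near ti tj.
Qed.

Lemma mero_affine_wp (g c p : C) : g != 0 -> mero (fun z => wp (g * z + c)) p.
Proof.
by move=> g0; have [h ha hP] := wp_affine_double_pole c p g0; exists h, 2%N.
Qed.

Lemma wp_affine_analytic (g c p : C) : g != 0 -> (forall k, pt k != g * p + c) ->
  analytic (fun z => wp (g * z + c)) p.
Proof. by move=> g0 h; apply: analytic_affine => //; apply: wp_analytic. Qed.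

Lemma relation_everywhere a alpha P (r : R) : alpha != 0 -> 0 < r ->
  (forall u, cabs u < r -> relation wp a alpha 0 P u) ->
  forall u, (forall k, pt k != u + a) -> (forall k, pt k != alpha * u + a) ->
    P.[(wp (alpha * u + a))%:P].[wp (u + a)] = 0.
Proof.
move=> alpha0 r0 Prel; pose F u := P.[(wp (alpha * u + a))%:P].[wp (u + a)].
have FE : F = (fun u => \sum_(k <- bidegrees P) P`_(k.2)`_(k.1) *
    (wp (1 * u + a) ^+ k.1 * wp (alpha * u + a) ^+ k.2)).
  by apply/funext => u; rewrite /F bivariate_horner mul1r.
have Fmero z : mero F z.
  rewrite FE; apply: mero_sum => k; apply: mero_mul.
    exact/mero_analytic/analytic_cst.
  by apply: mero_mul; apply: mero_exp; apply: mero_affine_wp; rewrite // oner_neq0.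
have F0 : punctured 0 (fun u => F u = 0).
  by exists r => // u _ /Prel; rewrite /relation addr0 add0r.
move=> u h1 h2; apply: (@analytic_punctured_eq0 _ F u).
  rewrite FE; apply: analytic_sum => k; apply: analytic_mul.
    exact: analytic_cst.
  apply: analytic_mul; apply: analytic_exp; apply: wp_affine_analytic => //.
  by rewrite mul1r.
by apply: identity_theorem F0 => z; apply: mero_dichotomy.
Qed.

Lemma wp_multiplier a (U : set C) alpha : chart_at_origin wp a U -> alpha != 0 ->
  (exists P (r : R), [/\ P != 0, 0 < r & forall u, cabs u < r ->
      [/\ U u, U (alpha * u) & relation wp a alpha 0 P u]]) ->
  multiplier w alpha.
Proof.
move=> aU alpha0 [P [r [P0 r0 rP]]].
have wpl := periodic_lattice (wp_lattice_periodic wnr).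
have U0 : U 0 by case: aU.
have [rho rho0 rhoP] := chart_near aU U0.
have {}rhoP v : cabs v < rho -> U v by move=> /rhoP; rewrite add0r.
have ca0 : 0 < cabs alpha by rewrite cabs_gt0.
have Prel := relation_everywhere alpha0 r0 (fun u ur => let: And3 _ _ h := rP u ur in h).
(* This keeps [alpha * u] within half of [rho]; the other half is for the translations. *)
pose d := Num.min rho (rho / 2 / cabs alpha).
have d0 : 0 < d by rewrite lt_min rho0 !divr_gt0.
have [u [ur urho Pu]] : exists u, [/\ cabs u < rho, cabs (alpha * u) < rho / 2 &
    (lead_coef P).[wp (u + a)] != 0].
  (* These points of the chart give [wp] pairwise distinct values, so they outnumber the zeros of
     the leading coefficient. The shift by 2 makes [t 0] strictly smaller than [d]. *)
  pose t (i : nat) : C := (d / i.+2%:R)%:C%C.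
  have td i : cabs (t i) < d.
    have i0 : 0 < i.+2%:R :> R by rewrite ltr0n.
    rewrite cabs_real gtr0_norm ?divr_gt0 // ltr_pdivrMr //.
    by rewrite ltr_pMr // ltr1n.
  have tU i : U (t i).
    by apply: rhoP; apply: lt_le_trans (td i) _; rewrite ge_min lexx.
  have tinj i j : wp (t i + a) = wp (t j + a) -> i = j.
    move=> /(chart_injective aU (tU i) (tU j))/complexI/(mulfI (lt0r_neq0 d0))/invr_inj.
    by move=> /eqP; rewrite eqr_nat => /eqP[].
  have lP0 : lead_coef P != 0 by rewrite lead_coef_eq0.
  pose s := [seq wp (t i + a) | i <- iota 0 (size (lead_coef P))].
  have us : uniq s by rewrite map_inj_uniq ?iota_uniq.
  have /allPn[_ /mapP[i _ ->] Pi] : ~~ all (root (lead_coef P)) s.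
    apply/negP => rs; have := max_poly_roots lP0 rs us.
    by rewrite size_map size_iota ltnn.
  exists (t i); split=> //; first by apply: lt_le_trans (td i) _; rewrite ge_min lexx.
  rewrite cabsM mulrC -ltr_pdivlMr //; apply: lt_le_trans (td i) _.
  by rewrite ge_min lexx orbT.
pose x := wp (u + a); pose Q := map_poly (horner_eval x) P.
have QE y : Q.[y] = P.[y%:P].[x].
  have {1}-> : y = horner_eval x y%:P by rewrite horner_evalE hornerC.
  exact: horner_map.
have Q0 : Q != 0.
  apply: contraNneq Pu => Q0; have := coef_map (horner_eval x) P (size P).-1.
  by rewrite -/Q Q0 coef0 -lead_coefE => h; apply/eqP/esym/h.
have avoid v j : (forall k, pt k != v) -> forall k, pt k != v + pt j.
  move=> h k; apply: contraNneq (h (k.1 - j.1, k.2 - j.2)) => kv.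
  by rewrite lattice_ptB kv addrK.
have torsion z : in_lattice w z -> exists2 N : nat, (0 < N)%N &
    in_lattice w (N%:R * (alpha * z)).
  move=> Lz; pose m := size Q; have m0 : 0 < m%:R :> R by rewrite ltr0n size_poly_gt0.
  have eta0 : 0 < rho / 2 / m%:R by rewrite !divr_gt0.
  have [N [l [N0 lN]]] := dirichlet_lattice (alpha * z) eta0.
  exists N => //; exists l; apply/eqP; rewrite -subr_eq0.
  (* If [e] is nonzero, the [m] points [alpha * u + k * e] lie in the chart, where [wp] is
     injective, and yield more roots than [Q] can have. *)
  set e := _ - _ in lN *; apply/negPn/negP => e0.
  have Ue k : (k < m)%N -> U (alpha * u + k%:R * e).
    move=> km; apply: rhoP; apply: le_lt_trans (cabsD _ _) _.
    rewrite (cabsM k%:R) cabs_nat; have : k%:R * cabs e <= m%:R * (rho / 2 / m%:R).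
      by apply: ler_pM; rewrite ?cabs_ge0 ?(ltW lN) // ler_nat ltnW.
    by rewrite [m%:R * _]mulrC divfK ?lt0r_neq0 //; lra.
  pose s := [seq wp (alpha * u + k%:R * e + a) | k <- iota 0 m].
  have us : uniq s.
    rewrite map_inj_in_uniq ?iota_uniq // => i j; rewrite !mem_iota !add0n /=.
    move=> im jm /(chart_injective aU (Ue i im) (Ue j jm))/addrI/(mulIf e0)/eqP.
    by rewrite eqr_nat => /eqP.
  have rs : all (root Q) s.
    apply/allP => _ /mapP[k + ->]; rewrite mem_iota add0n /= => km.
    have [j jE] := in_lattice_nat (k * N) Lz.
    have [j' j'E] := in_lattice_nat k (in_lattice_pt w l).
    (* Here [pt j = k * N * z] is a period, which leaves the first argument unchanged modulo the
       lattice; the second moves by [k * e] modulo the lattice. *)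
    have u1 : u + pt j + a = u + a + pt j by rewrite addrAC.
    have u2 : alpha * (u + pt j) + a = alpha * u + k%:R * e + a + pt j'.
      by rewrite -jE -j'E /e natrM; ring.
    have := Prel (u + pt j); rewrite u1 u2 !wpl => h.
    rewrite /root QE /x; apply/eqP/h; apply: avoid => i.
      exact: chart_avoids_lattice aU (rhoP _ ur).
    exact: chart_avoids_lattice aU (Ue k km).
  by have := max_poly_roots Q0 rs us; rewrite size_map size_iota ltnn.
have [N1 N10 h1] := torsion _ (in_lattice1 w).
have [N2 N20 h2] := torsion _ (in_lattice_w w).
(* One integer clears the torsion of both [alpha] and [alpha * w]. *)
exists (N1 * N2)%N; first by rewrite muln_gt0 N10.
rewrite mulr1 in h1; split.
  by rewrite natrM mulrAC mulrC; apply: in_lattice_nat.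
by rewrite natrM -!mulrA; apply: in_lattice_nat.
Qed.

Lemma K_V x : (K_ w `\ 0) x -> (K_ w `\ 0) x^-1.
Proof.
move=> [Kx /eqP x0]; split; last by apply/eqP; rewrite invr_eq0.
by apply: multiplier_K => //; apply: multiplierV => //; apply: K_multiplier.
Qed.

Lemma Aut_isog_units_wp : Aut_isog_units wp (K_ w).
Proof.
apply: Aut_isog_units_scale => [|a U alpha aU alpha0 rel|a U alpha b aU [Ka /eqP a0]].
- exact: K_V.
- by apply: multiplier_K => //; apply: wp_multiplier aU alpha0 rel.
- by apply: wp_relation => //; apply: K_multiplier.
Qed.

End WeierstrassCase.

Theorem proposition3p2 (R : realType) :
  [/\ Aut_isog_units (fun u : Cplx R => u) [set: Cplx R],
      Aut_isog_units (@cexp R) (@rationals R)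
    & forall w : Cplx R, w \isn't Num.real ->
        Aut_isog_units (weierstrass_p w) (K_ w)].
Proof.
split; [exact: Aut_isog_units_id|exact: Aut_isog_units_cexp|].
by move=> w wnr; apply: Aut_isog_units_wp.
Qed.
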